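(* Let $X,Y$ be jointly distributed real random variables, each discrete or continuous, with copula density $\mathrm{cop}(u,v;X,Y)$ that is square integrable on $(0,1)^2$. Let $S_j(u;X)$, $S_k(v;Y)$ be the LP unit score functions and $\mathrm{LP}(j,k;X,Y)=E[T_j(X;X)T_k(Y;Y)]$ the LP comoments. Then the copula density admits the representation as a series of LP product score functions $$\mathrm{cop}(u,v;X,Y)-1=\sum_{j,k>0}\mathrm{LP}(j,k;X,Y)\,S_j(u;X)\,S_k(v;Y),\qquad 0<u,v<1,$$ with convergence in $L^2((0,1)^2)$. Equivalently, for all $j,k>0$, $$\int_{[0,1]^2} d\big(v;Y,Y|X=Q(u;X)\big)\,S_j(u;X)\,S_k(v;Y)\,du\,dv=\mathrm{LP}(j,k;X,Y).$$
   Context: For a non-degenerate real random variable $Z$, discrete (countably many values, mass function) or continuous (with probability density), put $F(z;Z)=\Pr[Z\le z]$, $p(z;Z)=\Pr[Z=z]$, $F^{\mathrm{mid}}(z;Z)=F(z;Z)-\tfrac12 p(z;Z)$, and $Q(u;Z)=\inf\{z:F(z;Z)\ge u\}$, $0<u<1$. LP score functions of $Z$: $T_0(z;Z)=1$, $T_1(z;Z)=\dfrac{F^{\mathrm{mid}}(z;Z)-\frac12}{\sigma(F^{\mathrm{mid}}(Z;Z))}$, where $\sigma$ denotes standard deviation. The functions $T_j(\cdot;Z)$, $j\ge0$, are obtained by Gram–Schmidt orthonormalization of the powers $1,T_1,T_1^2,\dots$ in $L^2$ of the distribution of $Z$ (positive leading coefficients). If $Z$ takes only $K<\infty$ values, only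 $T_0,\dots,T_{K-1}$ exist; sums over $j>0$ run over the existing indices. LP unit score functions: $S_j(u;Z)=T_j(Q(u;Z);Z)$. Comparison density: for distributions $G,F$ with densities (or mass functions) $g,f$, $d(u;G,F)=f(Q(u;G))/g(Q(u;G))$, $0<u<1$, where $Q(\cdot;G)$ is the quantile function of $G$. The notation $d(v;Y,Y|X=x)$ means $d(v;G,F)$ with $G$ the distribution of $Y$ and $F$ the conditional distribution of $Y$ given $X=x$; that is, the conditional density (mass function) of $Y$ given $X=x$ divided by the marginal density (mass function) of $Y$, evaluated at $y=Q(v;Y)$. It is assumed that the joint law of $(X,Y)$ is absolutely continuous with respect to the product of its marginal laws. Copula density: $\mathrm{cop}(u,v;X,Y)=d(v;Y,Y|X=Q(u;X))=d(u;X,X|Y=Q(v;Y))$, $0<u,v<1$. Thus it is the Radon–Nikodym derivative of the joint law with respect to the product of the marginal laws, evaluated at $(Q(u;X),Q(v;Y))$: e.g. $p(x,y)/(p(x;X)p(y;Y))$ in the discrete case and $f(x,y)/(f(x;X)f(y;Y))$ in the continuous case, with $x=Q(u;X)$, $y=Q(v;Y)$. *)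

(* Defs.v *)
From HB Require Import structures.
From mathcomp Require Import all_boot all_order all_algebra finmap.
From mathcomp Require Import all_classical all_reals all_analysis.
From mathcomp Require Export summability.

Set Implicit Arguments.
Unset Strict Implicit.
Unset Printing Implicit Defensive.

Import Order.TTheory GRing.Theory Num.Theory.
Import numFieldNormedType.Exports.

Local Open Scope classical_set_scope.
Local Open Scope ring_scope.

Section densities.
Context {R : realType}.
Implicit Types (mu : set R -> \bar R) (f : R -> R).

Definition is_mass_function mu f : Prop :=
  (exists C : set R, countable C /\ mu (~` C) = 0%E) /\
  (forall z, mu [set z] = (f z)%:E).

Definition is_prob_density mu f : Prop :=
  [/\ measurable_fun [set: R] f, forall z, 0 <= f z &
      forall A : set R, measurable A ->
        mu A = (\int[@lebesgue_measure R]_(z in A) (f z)%:E)%E].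

(* A probability measure cannot satisfy both disjuncts, for any two [f]. *)
Definition is_density mu f : Prop :=
  is_mass_function mu f \/ is_prob_density mu f.

End densities.

Section random_variables.
Context {d : measure_display} {Omega : measurableType d} {R : realType}
  {P : probability Omega R}.
Implicit Types X Y Z : {RV P >-> R}.

Definition discrete_or_continuous Z : Prop :=
  exists f, is_density (distribution P Z) f.

Definition nondegenerate_RV Z : Prop :=
  forall c, distribution P Z [set c] <> 1%E.

(* [kappa] is a regular conditional distribution of Y given X. *)
Definition is_conditional_law X Y (kappa : R.-pker R ~> R) : Prop :=
  forall A B : set R, measurable A -> measurable B ->
    P (X @^-1` A `&` Y @^-1` B) =
    (\int[distribution P X]_(x in A) kappa x B)%E.

(* [f x] is the density, or mass function, of Y given X = x; as usual, it is
   only determined for almost every x under the law of X. When Y is discrete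
   (resp. continuous), absolute continuity of the joint law with respect to
   the product of its marginals forces almost every [f x] to be a mass
   function (resp. a probability density). *)
Definition is_conditional_density X Y (f : R -> R -> R) : Prop :=
  measurable_fun [set: R * R] (fun xy => f xy.1 xy.2) /\
  exists kappa : R.-pker R ~> R, is_conditional_law X Y kappa /\
    {ae distribution P X, forall x, is_density (kappa x) (f x)}.

Definition joint_law X Y : set (R * R) -> \bar R :=
  pushforward P (fun w => (X w, Y w)).

Definition quantile Z (u : R) : R := inf [set z | (u%:E <= cdf Z z)%E].

Definition Fmid Z (z : R) : R := fine (cdf Z z) - pmf Z z / 2.

Definition LP_score1 Z (z : R) : R :=
  (Fmid Z z - 2^-1) / Num.sqrt (fine 'V_P[Fmid Z \o Z]).

Definition L2_inner Z (f g : R -> R) : R :=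
  fine 'E_P[(fun w => f (Z w) * g (Z w))].

(* The first [n] Gram-Schmidt orthonormalized powers of [LP_score1 Z]. When a power is
   a linear combination of the previous ones in L^2, division by 0 yields the
   zero function in its place. *)
Fixpoint LP_score_seq Z (n : nat) : seq (R -> R) :=
  if n is m.+1 then
    let s := LP_score_seq Z m in
    let h := fun z => LP_score1 Z z ^+ m in
    let v := fun z => h z - \sum_(e <- s) L2_inner Z h e * e z in
    rcons s (fun z => v z / Num.sqrt (L2_inner Z v v))
  else [::].

Definition LP_score Z (j : nat) : R -> R :=
  nth (fun=> 0) (LP_score_seq Z j.+1) j.

Definition LP_unit_score Z (j : nat) (u : R) : R := LP_score Z j (quantile Z u).

Definition takes_values Z (K : nat) : Prop :=
  ([set z | 0 < pmf Z z] #= `I_K)%card /\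
  distribution P Z [set z | 0 < pmf Z z] = 1%E.

(* The indices j > 0 for which the score function T_j exists. *)
Definition LP_indices Z : set nat :=
  [set j | (0 < j)%N /\ forall K, takes_values Z K -> (j < K)%N].

Definition LP_comoment X Y (j k : nat) : R :=
  fine 'E_P[(fun w => LP_score X j (X w) * LP_score Y k (Y w))].

(* d(u; G, F) for G the law of Z, with [g] and [f] the densities (or mass
   functions) of G and F. *)
Definition comparison_density Z (g f : R -> R) (u : R) : R :=
  f (quantile Z u) / g (quantile Z u).

(* d(v; Y, Y | X = Q(u; X)), for [fY] the density (or mass function) of Y and
   [fYX] the conditional density (or mass function) of Y given X. *)
Definition copula_density X Y (fY : R -> R) (fYX : R -> R -> R) (u v : R) : R :=
  comparison_density Y fY (fYX (quantile X u)) v.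

End random_variables.

(* Quantile functions are only meaningful inside the open square. *)
Definition unit_square {R : realType} :
    set (measurableTypeR R * measurableTypeR R) :=
  (`]0, 1[ `*` `]0, 1[)%classic.

Definition lebesgue2 {R : realType} :
    {measure set (measurableTypeR R * measurableTypeR R) -> \bar R} :=
  (@lebesgue_measure R \x @lebesgue_measure R)%E.

(* Main.v *)
Require Import Defs.
From HB Require Import structures.
From mathcomp Require Import all_boot all_order all_algebra finmap.
From mathcomp Require Import all_classical all_reals all_analysis.
From mathcomp Require Import measurable_realfun ring lra.

Set Implicit Arguments.
Unset Strict Implicit.
Unset Printing Implicit Defensive.

Import Order.TTheory GRing.Theory Num.Theory.
Import numFieldNormedType.Exports.

Local Open Scope classical_set_scope.
Local Open Scope ring_scope.

(** Let m be the product of the laws mu of X and nu of Y. The quantile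
transform pushes Lebesgue measure on (0,1) forward to the law, so every
integral over the unit square becomes an integral against m. By Radon-Nikodym
the joint law has a density with respect to m; disintegrating it along the
conditional laws shows that it equals fYX x y / fY y almost everywhere, whence
LP(j,k) is the coefficient of this quotient on T_j(x) T_k(y).

The products T_j(x) T_k(y) are orthogonal of norm 0 or 1, so it remains to see
that they span a dense subspace of L^2(m). Their span is the algebra generated
by Fmid(x) and Fmid(y). The bounded functions in the L^2-closure of an algebra form an
algebra stable under bounded pointwise limits, hence contain the indicators of
all sets [s > 0] with s in the algebra. Up to null sets, [x > a] is
[Fmid(x) > Fmid(a)], so all indicators of Borel sets are reached. *)

(** * Square integrable functions over a probability space *)

(** If [Z] takes only K values, the scores from index K on are divisions by 0, hence zero functions.
    Keeping these spurious scores lets orthogonality and density be proved for all indices alike;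
    [LP_score_finite] shows that the series loses nothing by omitting them. Apart from the quotient
    itself, the algebra takes place among bounded functions, where products raise no integrability
    question. Regular conditional laws are tied to the joint law only after integration in x. The
    quotient is therefore identified with the Radon-Nikodym derivative one x at a time, and this
    requires a null set of x that does not depend on the Borel set in y. Convergence rests on best
    approximation, not on Parseval: the remainder over J is orthogonal to the subtracted sum and to
    every element of the span with indices in J, so Pythagoras bounds its norm by the distance from
    the quotient to such an element. This yields at once the limit along all finite index sets,
    whatever the order of summation. *)

Section L2.
Context {d} {T : measurableType d} {R : realType} (m : probability T R).
Implicit Types f g h : T -> R.

Definition bounded_mfun f :=
  measurable_fun setT f /\ exists M : R, forall x, `|f x| <= M.

Definition sq_integrable f :=
  measurable_fun setT f /\ m.-integrable setT (EFin \o (fun x => (f x ^+ 2)%R)).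

Definition dot f g : R := \int[m]_x (f x * g x).

Lemma bounded_mfun_integrable f :
  bounded_mfun f -> m.-integrable setT (EFin \o f).
Proof.
move=> [mf [M fM]]; apply: measurable_bounded_integrable => //.
  by rewrite -ge0_fin_numE ?fin_num_measure.
by exists M; split; rewrite ?num_real// => y My x _ /=; rewrite (le_trans (fM x))// ltW.
Qed.

Lemma bounded_mfun_cst c : bounded_mfun (fun=> c).
Proof. by split => //; exists `|c|. Qed.

Lemma bounded_mfunD f g :
  bounded_mfun f -> bounded_mfun g -> bounded_mfun (fun x => f x + g x).
Proof.
move=> [mf [M fM]] [mg [N gN]]; split; first exact: measurable_funD.
by exists (M + N) => x; rewrite (le_trans (ler_normD _ _))// lerD.
Qed.

Lemma bounded_mfunM f g :
  bounded_mfun f -> bounded_mfun g -> bounded_mfun (fun x => f x * g x).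
Proof.
move=> [mf [M fM]] [mg [N gN]]; split; first exact: measurable_funM.
by exists (M * N) => x; rewrite normrM ler_pM.
Qed.

Lemma bounded_mfunB f g :
  bounded_mfun f -> bounded_mfun g -> bounded_mfun (fun x => f x - g x).
Proof.
move=> bf bg; rewrite (_ : (fun x => _) = fun x => f x + (- 1) * g x).
  by apply: bounded_mfunD => //; apply: bounded_mfunM => //; exact: bounded_mfun_cst.
by apply/funext => x; rewrite mulN1r.
Qed.

Lemma bounded_mfunX f n : bounded_mfun f -> bounded_mfun (fun x => f x ^+ n).
Proof.
move=> bf; elim: n => [|n IH].
  by under eq_fun do rewrite expr0; exact: bounded_mfun_cst.
by under eq_fun do rewrite exprS; exact: bounded_mfunM.
Qed.

Lemma bounded_mfun_sum I (s : seq I) (F : I -> T -> R) :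
  (forall i, bounded_mfun (F i)) -> bounded_mfun (fun x => \sum_(i <- s) F i x).
Proof.
move=> bF; elim: s => [|i s IH].
  by under eq_fun do rewrite big_nil; exact: bounded_mfun_cst.
by under eq_fun do rewrite big_cons; exact: bounded_mfunD.
Qed.

Lemma bounded_mfun_indic (A : set T) : measurable A -> bounded_mfun \1_A.
Proof.
by move=> mA; split => //; exists 1 => x; rewrite indicE ger0_norm// lern1 leq_b1.
Qed.

Lemma bounded_sq_integrable f : bounded_mfun f -> sq_integrable f.
Proof.
by move=> bf; split; [case: bf|exact/bounded_mfun_integrable/bounded_mfunX].
Qed.

Lemma sq_integrable_le f g : measurable_fun setT f ->
  (forall x, `|f x| <= `|g x|) -> sq_integrable g -> sq_integrable f.
Proof.
move=> mf fg [mg ig]; split => //.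
apply: le_integrable ig => //.
  by apply/measurable_EFinP; exact: measurable_funX.
move=> x _ /=; rewrite lee_fin !normrX lerXn2r ?nnegrE//.
Qed.

Lemma sq_integrableM f g :
  sq_integrable f -> sq_integrable g ->
  m.-integrable setT (EFin \o (fun x => (f x * g x)%R)).
Proof.
move=> [mf if_] [mg ig].
apply: (@le_integrable _ _ _ _ _ _ _ (EFin \o (fun x => f x ^+ 2 + g x ^+ 2))) => //.
- by apply/measurable_EFinP; exact: measurable_funM.
- move=> x _ /=; rewrite lee_fin [leRHS]ger0_norm ?addr_ge0 ?sqr_ge0//.
  rewrite ler_norml; apply/andP; split; nra.
- by rewrite (_ : _ \o _ = (EFin \o (fun x => (f x ^+ 2)%R)) \+ (EFin \o (fun x => (g x ^+ 2)%R)))%E //; exact: integrableD.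
Qed.

Lemma sq_integrableD f g :
  sq_integrable f -> sq_integrable g -> sq_integrable (fun x => f x + g x).
Proof.
move=> sf sg; have [mf if_] := sf; have [mg ig] := sg.
split; first exact: measurable_funD.
rewrite (_ : _ \o _ = (EFin \o (fun x => (f x ^+ 2)%R)) \+
   ((fun x => 2%:E * (EFin \o (fun x => (f x * g x)%R)) x)
     \+ (EFin \o (fun x => (g x ^+ 2)%R))))%E.
  by do 2 (apply: integrableD => //); apply: integrableZl => //; exact: sq_integrableM.
by apply/funext => x /=; rewrite -EFinM -!EFinD; congr EFin; ring.
Qed.

Lemma sq_integrableZ c f : sq_integrable f -> sq_integrable (fun x => c * f x).
Proof.
move=> [mf if_]; split; first exact: measurable_funM.
rewrite (_ : _ \o _ = (fun x => (c ^+ 2)%:E * (EFin \o (fun x => (f x ^+ 2)%R)) x))%E.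
  exact: integrableZl.
by apply/funext => x /=; rewrite -EFinM exprMn.
Qed.

Lemma sq_integrableB f g :
  sq_integrable f -> sq_integrable g -> sq_integrable (fun x => f x - g x).
Proof.
move=> sf sg; rewrite (_ : (fun x => _) = fun x => f x + (- 1) * g x).
  by apply: sq_integrableD => //; exact: sq_integrableZ.
by apply/funext => x; rewrite mulN1r.
Qed.

Lemma sq_integrable_sum I (s : seq I) (F : I -> T -> R) :
  (forall i, sq_integrable (F i)) -> sq_integrable (fun x => \sum_(i <- s) F i x).
Proof.
move=> bF; elim: s => [|i s IH].
  under eq_fun do rewrite big_nil.
  exact/bounded_sq_integrable/bounded_mfun_cst.
by under eq_fun do rewrite big_cons; exact: sq_integrableD.
Qed.

Lemma dotC f g : dot f g = dot g f.
Proof. by rewrite /dot; apply: eq_Rintegral => x _; rewrite mulrC. Qed.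

Lemma dotDr f g h : sq_integrable f -> sq_integrable g -> sq_integrable h ->
  dot f (fun x => g x + h x) = dot f g + dot f h.
Proof.
move=> sf sg sh; rewrite /dot -RintegralD//; try exact: sq_integrableM.
by apply: eq_Rintegral => x _; rewrite mulrDr.
Qed.

Lemma dotZr f g c : sq_integrable f -> sq_integrable g ->
  dot f (fun x => c * g x) = c * dot f g.
Proof.
move=> sf sg; rewrite /dot -RintegralZl//; last exact: sq_integrableM.
by apply: eq_Rintegral => x _; rewrite mulrCA.
Qed.

Lemma dotBr f g h : sq_integrable f -> sq_integrable g -> sq_integrable h ->
  dot f (fun x => g x - h x) = dot f g - dot f h.
Proof.
move=> sf sg sh; rewrite /dot -RintegralB//; try exact: sq_integrableM.
by apply: eq_Rintegral => x _; rewrite mulrBr.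
Qed.

Lemma dotBl f g h : sq_integrable f -> sq_integrable g -> sq_integrable h ->
  dot (fun x => g x - h x) f = dot g f - dot h f.
Proof. by move=> *; rewrite dotC dotBr// !(dotC f). Qed.

Lemma dot0r f : dot f (fun=> 0) = 0.
Proof. by rewrite /dot; under eq_Rintegral do rewrite mulr0; rewrite Rintegral_cst// mul0r. Qed.

Lemma dot_sumr I (s : seq I) f (F : I -> T -> R) : sq_integrable f ->
  (forall i, sq_integrable (F i)) ->
  dot f (fun x => \sum_(i <- s) F i x) = \sum_(i <- s) dot f (F i).
Proof.
move=> sf sF; elim: s => [|i s IH].
  by rewrite big_nil; under [X in dot _ X]eq_fun do rewrite big_nil; exact: dot0r.
rewrite big_cons -IH -dotDr//; last exact: sq_integrable_sum.
by congr dot; apply/funext => x; rewrite big_cons.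
Qed.

Lemma dot_ge0 f : 0 <= dot f f.
Proof. by apply: Rintegral_ge0 => x _; rewrite -expr2 sqr_ge0. Qed.

Lemma dot_le f g : measurable_fun setT f -> sq_integrable g ->
  (forall x, `|f x| <= `|g x|) -> dot f f <= dot g g.
Proof.
move=> mf sg fg; have sf := sq_integrable_le mf fg sg.
apply: le_Rintegral => //; try exact: sq_integrableM.
by move=> x _; rewrite -!expr2 -[f x ^+ 2]ger0_norm ?sqr_ge0// -[g x ^+ 2]ger0_norm ?sqr_ge0// !normrX lerXn2r ?nnegrE.
Qed.

(** The pointwise bound $(a + b)^2 \le 2a^2 + 2b^2$ serves as triangle inequality, so that later
    estimates stay in terms of squared distances. *)
Lemma dotDD_le f g : sq_integrable f -> sq_integrable g ->
  dot (fun x => f x + g x) (fun x => f x + g x) <= 2 * dot f f + 2 * dot g g.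
Proof.
move=> sf sg; rewrite /dot -!RintegralZl//; try exact: sq_integrableM.
rewrite -RintegralD//; first last.
- by rewrite (_ : _ \o _ = (fun x => 2%:E * (EFin \o (fun x => (g x * g x)%R)) x)%E)//;
    apply: integrableZl => //; exact: sq_integrableM.
- by rewrite (_ : _ \o _ = (fun x => 2%:E * (EFin \o (fun x => (f x * f x)%R)) x)%E)//;
    apply: integrableZl => //; exact: sq_integrableM.
apply: le_Rintegral => //.
- by apply: sq_integrableM; exact: sq_integrableD.
- rewrite (_ : _ \o _ = (fun x => 2%:E * (EFin \o (fun x => (f x * f x)%R)) x)
    \+ (fun x => 2%:E * (EFin \o (fun x => (g x * g x)%R)) x))%E//.
  by apply: integrableD => //; apply: integrableZl => //; exact: sq_integrableM.
- move=> x _; have := sqr_ge0 (f x - g x); nra.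
Qed.

Lemma dot_eq0_ae f : sq_integrable f -> dot f f = 0 -> {ae m, forall x, f x = 0}.
Proof.
move=> sf f0.
have if_ := sq_integrableM sf sf.
have : (\int[m]_x `|(f x * f x)%:E| = 0)%E.
  rewrite (eq_integral (fun x => (f x * f x)%:E)); last first.
    by move=> x _; rewrite gee0_abs// lee_fin -expr2 sqr_ge0.
  by rewrite -[LHS]fineK ?integrable_fin_num//; congr EFin.
have mff : measurable_fun setT (fun x => (f x * f x)%:E) by case/integrableP: if_.
move/(ae_eq_integral_abs m measurableT mff); apply: filterS => x /(_ I) /= [] /eqP.
by rewrite mulf_eq0 orbb => /eqP.
Qed.

Lemma dot_ae f g h : measurable_fun setT f -> measurable_fun setT g ->
  measurable_fun setT h ->
  {ae m, forall x, f x = g x} -> dot h f = dot h g.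
Proof.
move=> mf mg mh fg; rewrite /dot /Rintegral; congr fine.
apply: ae_eq_integral => //; try by apply/measurable_EFinP; exact: measurable_funM.
by apply: filterS fg => x /= -> .
Qed.

End L2.

(** * L2-closure of an algebra of bounded functions *)

Section approx_norm.
Context {R : realType}.

(* Newton-type iteration p -> p + (s^2 - p^2)/2, converging to |s| on [-1, 1]. *)
Fixpoint approx_norm (n : nat) (s : R) : R :=
  if n is n'.+1 then
    approx_norm n' s + 2^-1 * (s * s - approx_norm n' s * approx_norm n' s)
  else 0.

(** Each step multiplies the error [|s| - p] by [1 - (|s| + p) / 2], which lies between 0 and
    [1 - |s| / 2] as long as [0 <= p <= |s| <= 1]. *)
Lemma approx_norm_bounds n s : `|s| <= 1 ->
  0 <= approx_norm n s /\ 0 <= `|s| - approx_norm n s <= `|s| * (1 - `|s| / 2) ^+ n.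
Proof.
move=> s1; have s0 := normr_ge0 s.
elim: n => [|n [p0 /andP[pS pn]]] /=; first by rewrite subr0 expr0 mulr1 lexx s0.
rewrite -[s * s]ger0_norm ?normrM; last by rewrite -expr2 sqr_ge0.
set p := approx_norm n s in p0 pS pn *; set a := `|s| in s1 s0 pS pn *.
split; first by nra.
have -> : a - (p + 2^-1 * (a * a - p * p)) = (a - p) * (1 - (a + p) / 2) by field.
apply/andP; split; first by apply: mulr_ge0 => //; lra.
rewrite exprSr mulrA; apply: ler_pM => //; lra.
Qed.

Lemma cvg_approx_norm s : `|s| <= 1 -> approx_norm n s @[n --> \oo] --> `|s|.
Proof.
move=> s1; apply/cvgrPdist_le => e e0.
have : `|s| * (1 - `|s| / 2) ^+ n @[n --> \oo] --> 0.
  (* At 0 the ratio of the geometric bound is 1, but its prefactor vanishes. *)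
  have [->|s0] := eqVneq s 0.
    by under eq_fun do rewrite normr0 mul0r; exact: cvg_cst.
  rewrite -(mulr0 `|s|); apply: cvgMr; apply: cvg_expr.
  have : 0 < `|s| by rewrite normr_gt0.
  by move=> ?; rewrite ger0_norm; lra.
move/cvgrPdist_le => /(_ e e0); apply: filterS => n.
have [_ /andP[h1 h2]] := approx_norm_bounds n s1.
rewrite sub0r normrN (ger0_norm h1); apply: le_trans; apply: le_trans h2 _.
exact: ler_norm.
Qed.

End approx_norm.

Section closure.
Context {d} {T : measurableType d} {R : realType} (m : probability T R).
Variable G : set (T -> R).
Hypothesis bG : forall g, G g -> bounded_mfun g.
Implicit Types f g h : T -> R.

(** An inductive presentation of the polynomials in members of [G]: induction on it gives
    boundedness and, later, membership in the span of the product scores. *)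
Inductive gen_algebra : (T -> R) -> Prop :=
| gen_algebra_gen g : G g -> gen_algebra g
| gen_algebra_cst c : gen_algebra (fun=> c)
| gen_algebraD f g : gen_algebra f -> gen_algebra g ->
    gen_algebra (fun x => f x + g x)
| gen_algebraM f g : gen_algebra f -> gen_algebra g ->
    gen_algebra (fun x => f x * g x).

Lemma gen_algebra_bounded f : gen_algebra f -> bounded_mfun f.
Proof.
elim=> {f} [g /bG//|c|f g _ bf _ bg|f g _ bf _ bg].
- exact: bounded_mfun_cst.
- exact: bounded_mfunD.
- exact: bounded_mfunM.
Qed.

Lemma gen_algebra_sq f : gen_algebra f -> sq_integrable m f.
Proof. by move=> /gen_algebra_bounded; exact: bounded_sq_integrable. Qed.

Notation dist f g := (dot m (fun x => f x - g x) (fun x => f x - g x)).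

Definition L2_closure f := sq_integrable m f /\
  forall e, 0 < e -> exists2 g, gen_algebra g & dist f g < e.

Lemma L2_closure_alg f : gen_algebra f -> L2_closure f.
Proof.
move=> Gf; split; first exact: gen_algebra_sq.
move=> e e0; exists f => //; under eq_fun do rewrite subrr.
by rewrite dot0r.
Qed.

Lemma dist_triangle f g h :
  sq_integrable m f -> sq_integrable m g -> sq_integrable m h ->
  dist f h <= 2 * dist f g + 2 * dist g h.
Proof.
move=> sf sg sh.
rewrite (_ : (fun x => f x - h x) = fun x => (f x - g x) + (g x - h x)).
  by apply: dotDD_le; exact: sq_integrableB.
by apply/funext => x; rewrite addrA subrK.
Qed.

Lemma L2_closure_lim f : sq_integrable m f ->
  (forall e, 0 < e -> exists2 g, L2_closure g & dist f g < e) -> L2_closure f.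
Proof.
move=> sf H; split => // e e0.
(* Each of the two errors is doubled by [dist_triangle]. *)
have e4 : 0 < e / 4 by rewrite divr_gt0.
have [g [sg cg] fg] := H _ e4; have [h Gh gh] := cg _ e4.
exists h => //; apply: le_lt_trans (dist_triangle sf sg (gen_algebra_sq Gh)) _.
by lra.
Qed.

Lemma L2_closureD f g : L2_closure f -> L2_closure g ->
  L2_closure (fun x => f x + g x).
Proof.
move=> [sf cf] [sg cg]; split; first exact: sq_integrableD.
move=> e e0; have e4 : 0 < e / 4 by rewrite divr_gt0.
have [f' Gf ff] := cf _ e4; have [g' Gg gg] := cg _ e4.
exists (fun x => f' x + g' x); first exact: gen_algebraD.
rewrite (_ : (fun x => _) = fun x => (f x - f' x) + (g x - g' x)); last first.
  by apply/funext => x; rewrite opprD addrACA.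
apply: le_lt_trans; first by apply: dotDD_le; apply: sq_integrableB => //; exact: gen_algebra_sq.
by lra.
Qed.

Lemma sq_integrableM_bounded f g M : sq_integrable m f -> bounded_mfun g ->
  (forall x, `|g x| <= M) -> sq_integrable m (fun x => f x * g x) /\
  dot m (fun x => f x * g x) (fun x => f x * g x) <= M ^+ 2 * dot m f f.
Proof.
move=> sf [mg _] gM; have [mf _] := sf.
have mfg : measurable_fun setT (fun x => f x * g x) by exact: measurable_funM.
have fgM x : `|f x * g x| <= `|M * f x|.
  rewrite !normrM mulrC ler_wpM2r// (le_trans (gM x))//.
  exact: ler_norm.
have sMf := sq_integrableZ M sf.
split; first exact: sq_integrable_le sMf.
apply: le_trans (dot_le mfg sMf fgM) _.
by rewrite (dotZr _ sMf sf) (dotC m _ f) (dotZr _ sf sf) mulrA -expr2.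
Qed.

(** Approximants of [f] and [g] need not be uniformly bounded, so the factors are replaced one at a
    time: [f] by some [w] in the algebra while the bounded [g] is fixed, then [g] while [w], bounded
    in its turn, is fixed. *)
Lemma L2_closureM f g : bounded_mfun f -> bounded_mfun g ->
  L2_closure f -> L2_closure g -> L2_closure (fun x => f x * g x).
Proof.
move=> bf bg [sf cf] [sg cg].
have key u v : bounded_mfun u -> sq_integrable m v -> forall e, 0 < e ->
    (forall e, 0 < e -> exists2 w, gen_algebra w & dist v w < e) ->
    exists2 w, gen_algebra w & dist (fun x => v x * u x) (fun x => w x * u x) < e.
  move=> bu sv e e0 cv; have [_ [M uM]] := bu.
  (* Adding 1 permits the division below even if [M] is 0. *)
  have M2 : 0 < M ^+ 2 + 1 by rewrite ltr_wpDl ?sqr_ge0.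
  have [w Gw vw] := cv (e / (M ^+ 2 + 1)) (divr_gt0 e0 M2).
  exists w => //.
  rewrite (_ : (fun x => v x * u x - _) = fun x => (v x - w x) * u x); last first.
    by apply/funext => x; rewrite mulrBl.
  have svw := sq_integrableB sv (gen_algebra_sq Gw).
  have [_ le] := sq_integrableM_bounded svw bu uM.
  apply: le_lt_trans le _; rewrite ltr_pdivlMr// in vw.
  apply: le_lt_trans vw; rewrite [leRHS]mulrC ler_wpM2r ?dot_ge0//.
  by rewrite lerDl.
have sfg : sq_integrable m (fun x => f x * g x).
  by apply: bounded_sq_integrable; exact: bounded_mfunM.
apply: L2_closure_lim => // e e0.
have [w Gw fw] := key _ _ bg sf e e0 cf.
exists (fun x => w x * g x) => //.
have bw := gen_algebra_bounded Gw.
apply: L2_closure_lim => [|e' e'0].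
  by apply: bounded_sq_integrable; exact: bounded_mfunM.
have [v Gv gv] := key _ _ bw sg e' e'0 cg.
exists (fun x => w x * v x); first by apply/L2_closure_alg/gen_algebraM.
rewrite (_ : (fun x => w x * g x - _) = fun x => g x * w x - v x * w x)//.
by apply/funext => x; rewrite !(mulrC (w x)).
Qed.

Lemma L2_closure_dominated (u : nat -> T -> R) f h : (forall n, L2_closure (u n)) ->
  sq_integrable m h -> (forall n x, `|u n x| <= h x) ->
  (forall x, u n x @[n --> \oo] --> f x) -> L2_closure f.
Proof.
move=> cu sh uh uf.
have mu n : measurable_fun setT (u n) by have [[]] := cu n.
have mf : measurable_fun setT f by apply: (measurable_fun_cvg mu) => x _; exact: uf.
have fh x : `|f x| <= h x.
  have /cvg_norm := uf x.
  by move/(cvgr_to_le (F := \oo)); apply; apply: nearW => n; exact: uh.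
have hn x : 0 <= h x by exact: le_trans (fh x).
have sf : sq_integrable m f.
  by apply: (sq_integrable_le mf _ sh) => x; rewrite [leRHS]ger0_norm.
apply: L2_closure_lim => // e e0.
pose D n x : R := (f x - u n x) * (f x - u n x).
have mD n : measurable_fun setT (D n) by apply: measurable_funM; exact: measurable_funB.
have : (\int[m]_x (D n x)%:E @[n --> \oo] --> \int[m]_x (cst 0%:E) x)%E.
  have [mh ih] := sh.
  (* Both [|f|] and [|u n|] are at most [h], so [(f - u n) ^+ 2] is at most [4 * h ^+ 2]. *)
  apply: (@dominated_cvg _ _ _ m _ measurableT _ _
    (fun x => 4%:E * (EFin \o (fun x => h x ^+ 2)%R) x)%E) => //.
  - by move=> n; exact/measurable_EFinP.
  - move=> x _; apply: cvg_EFin; first exact: nearW.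
    rewrite (_ : 0 = (f x - f x) * (f x - f x)); last by rewrite subrr mul0r.
    by apply: cvgM; (apply: cvgB; [exact: cvg_cst|exact: uf]).
  - exact: integrableZl.
  - move=> n x _ /=; rewrite lee_fin /D ger0_norm; last by rewrite -expr2 sqr_ge0.
    have := fh x; have := uh n x; have := hn x; rewrite !ler_norml.
    by move=> ? /andP[? ?] /andP[? ?]; nra.
rewrite integral0 => /fine_cvg /cvgrPdist_lt /(_ _ e0) [N _ /(_ N (leqnn N))] /=.
rewrite sub0r normrN => lt; exists (u N) => //.
by apply: le_lt_trans lt; exact: ler_norm.
Qed.

Lemma L2_closure_bounded_cvg (u : nat -> T -> R) f M : (forall n, L2_closure (u n)) ->
  (forall n x, `|u n x| <= M) ->
  (forall x, u n x @[n --> \oo] --> f x) -> L2_closure f.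
Proof.
move=> cu uM; apply: (L2_closure_dominated cu _ uM).
exact/bounded_sq_integrable/bounded_mfun_cst.
Qed.

Lemma L2_closure_ae f g : measurable_fun setT f -> bounded_mfun f ->
  {ae m, forall x, f x = g x} -> L2_closure g -> L2_closure f.
Proof.
move=> mf bf fg cg; have [[mg _] _] := cg.
apply: L2_closure_lim; first exact: bounded_sq_integrable.
move=> e e0; exists g => //.
have fg0 : {ae m, forall x, f x - g x = 0}.
  by apply: filterS fg => x ->; rewrite subrr.
have mfg : measurable_fun setT (fun x => f x - g x) by exact: measurable_funB.
by rewrite (dot_ae mfg _ mfg fg0) ?dot0r.
Qed.

Definition bounded_closure f := bounded_mfun f /\ L2_closure f.

Lemma bounded_closure_cst c : bounded_closure (fun=> c).
Proof. by split; [exact: bounded_mfun_cst|exact/L2_closure_alg/gen_algebra_cst]. Qed.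

Lemma bounded_closureD f g : bounded_closure f -> bounded_closure g ->
  bounded_closure (fun x => f x + g x).
Proof. by move=> [? ?] [? ?]; split; [exact: bounded_mfunD|exact: L2_closureD]. Qed.

Lemma bounded_closureM f g : bounded_closure f -> bounded_closure g ->
  bounded_closure (fun x => f x * g x).
Proof. by move=> [? ?] [? ?]; split; [exact: bounded_mfunM|exact: L2_closureM]. Qed.

Lemma bounded_closureB f g : bounded_closure f -> bounded_closure g ->
  bounded_closure (fun x => f x - g x).
Proof.
move=> cf cg; rewrite (_ : (fun x => _) = fun x => f x + (- 1) * g x).
  by apply: bounded_closureD => //; apply: bounded_closureM => //; exact: bounded_closure_cst.
by apply/funext => x; rewrite mulN1r.
Qed.

Lemma bounded_closureX f n : bounded_closure f ->
  bounded_closure (fun x => f x ^+ n).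
Proof.
move=> cf; elim: n => [|n IH].
  by under eq_fun do rewrite expr0; exact: bounded_closure_cst.
by under eq_fun do rewrite exprS; exact: bounded_closureM.
Qed.

(** With $s^+ = (s + |s|)/2$ in [0, 1], the indicator is the pointwise limit of $1 - (1 - s^+)^k$.
    For fixed k, $|s|$ is in turn the limit of the polynomials [approx_norm n] in s. *)
Lemma L2_closure_gt0 s : bounded_closure s -> (forall x, `|s x| <= 1) ->
  L2_closure \1_[set x | 0 < s x].
Proof.
move=> cs s1.
have cp n : bounded_closure (fun x => approx_norm n (s x)).
  elim: n => [|n IH] /=; first exact: bounded_closure_cst.
  apply: bounded_closureD => //; apply: bounded_closureM.
    exact: bounded_closure_cst.
  by apply: bounded_closureB; exact: bounded_closureM.
have norm1 (y : R) k : 0 <= y <= 1 -> `|1 - (1 - y) ^+ k| <= 1.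
  move=> /andP[y0 y1].
  have : 0 <= (1 - y) ^+ k <= 1 by rewrite exprn_ge0 ?exprn_ile1//; lra.
  by move=> /andP[? ?]; rewrite ger0_norm; lra.
have cw k : L2_closure (fun x => 1 - (1 - (s x + `|s x|) / 2) ^+ k).
  (* The crude bound [1 + 2 ^+ k] suffices because [k] stays fixed while [n] grows. *)
  apply: (@L2_closure_bounded_cvg
      (fun n x => 1 - (1 - (s x + approx_norm n (s x)) * 2^-1) ^+ k) _ (1 + 2 ^+ k)).
  - move=> n; suff [] : bounded_closure (fun x => 1 - (1 - (s x + approx_norm n (s x)) * 2^-1) ^+ k) by [].
    apply: bounded_closureB; first exact: bounded_closure_cst.
    apply: bounded_closureX; apply: bounded_closureB; first exact: bounded_closure_cst.
    by apply: bounded_closureM; [exact: bounded_closureD|exact: bounded_closure_cst].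
  - move=> n x; have [p0 /andP[p1 _]] := approx_norm_bounds n (s1 x).
    have := s1 x; move: p1; rewrite ler_norml subr_ge0 => p1 /andP[h1 h2].
    have h : `|1 - (s x + approx_norm n (s x)) / 2| <= 2.
      have := s1 x => ?; have [sx|sx] := leP 0 (s x).
        by rewrite (ger0_norm sx) in p1; rewrite ler_norml; lra.
      rewrite (ltr0_norm sx) in p1; rewrite ler_norml; lra.
    rewrite (le_trans (ler_normB _ _))// normr1 normrX lerD2l.
    by rewrite lerXn2r ?nnegrE.
  - move=> x; apply: cvgB; first exact: cvg_cst.
    apply: (@cvg_comp _ _ _ _ (fun y : R => y ^+ k)); last exact: exprn_continuous.
    apply: cvgB; first exact: cvg_cst.
    apply: cvgMl; apply: cvgD; first exact: cvg_cst.
    exact: cvg_approx_norm.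
apply: (L2_closure_bounded_cvg (M := 1) cw) => [k x|x].
  apply: norm1; have := s1 x; have := ler_norm (s x); have := ler_norm (- s x).
  by rewrite normrN; lra.
rewrite indicE; have [sx|sx] := ltP 0 (s x).
  rewrite mem_set//= (gtr0_norm sx).
  rewrite (_ : (fun k => _) = fun k => 1 - (1 - s x) ^+ k); last first.
    by apply/funext => k; congr (1 - (1 - _) ^+ k); field.
  rewrite -[X in _ --> X](subr0 1); apply: cvgB; first exact: cvg_cst.
  apply: cvg_expr.
  by have := s1 x; rewrite (gtr0_norm sx) => ?; rewrite ger0_norm; lra.
rewrite memNset/=; last by apply/negP; rewrite -leNgt.
under eq_fun do rewrite (ler0_norm sx) subrr mul0r subr0 expr1n subrr.
exact: cvg_cst.
Qed.

Definition closure_sets := [set A | measurable A /\ L2_closure \1_A].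

Lemma bounded_closure_sets A : closure_sets A -> bounded_closure \1_A.
Proof. by move=> [mA cA]; split => //; exact: bounded_mfun_indic. Qed.

Lemma closure_setsC A : closure_sets A -> closure_sets (~` A).
Proof.
move=> cA; have [mA _] := cA; split; first exact: measurableC.
rewrite (_ : \1_(~` A) = fun x => 1 - \1_A x :> R).
  by apply: (bounded_closureB _ _).2; [exact: bounded_closure_cst|exact: bounded_closure_sets].
by apply/funext => x; rewrite !indicE in_setC; case: (x \in A); rewrite /= ?subrr ?subr0.
Qed.

Lemma closure_setsI A B : closure_sets A -> closure_sets B -> closure_sets (A `&` B).
Proof.
move=> cA cB; have [mA _] := cA; have [mB _] := cB; split; first exact: measurableI.
rewrite (_ : \1_(A `&` B) = fun x => \1_A x * \1_B x :> R).
  by apply: (bounded_closureM _ _).2; exact: bounded_closure_sets.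
by rewrite indicI.
Qed.

(** Finite unions come from complements and intersections, and their indicators converge boundedly
    to that of the whole union. *)
Lemma closure_sets_bigcup (F : nat -> set T) : (forall n, closure_sets (F n)) ->
  closure_sets (\bigcup_n F n).
Proof.
move=> cF; split; first by apply: bigcup_measurable => n _; have [] := cF n.
pose U n := \bigcup_(k < n) F k.
have cU n : closure_sets (U n).
  rewrite /U bigcup_mkord; elim: n => [|n IH].
    rewrite big_ord0; split => //.
    by rewrite indic0; have [] := bounded_closure_cst 0.
  rewrite big_ord_recr/= -[X in closure_sets X]setCK setCU.
  by apply/closure_setsC/closure_setsI; exact: closure_setsC.
apply: (@L2_closure_bounded_cvg (fun n => \1_(U n)) _ 1).
- by move=> n; have [] := cU n.
- by move=> n x; rewrite indicE ger0_norm// lern1 leq_b1.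
- move=> x; have [[N _ FN]|nF] := pselect ((\bigcup_n F n) x).
    apply: cvg_near_cst; exists N.+1 => // n /= Nn.
    by rewrite !indicE !mem_set//; [exists N|exists N].
  apply: cvg_near_cst; apply: nearW => n; rewrite !indicE !memNset// => -[k _ Fk].
  by apply: nF; exists k.
Qed.

End closure.

(** * From measurable sets to all square integrable functions *)

Section closure_full.
Context {d} {T : measurableType d} {R : realType} (m : probability T R).
Variable G : set (T -> R).
Hypothesis bG : forall g, G g -> bounded_mfun g.

Lemma closure_sets_sigma_algebra : sigma_algebra setT (closure_sets m G).
Proof.
have c0 : closure_sets m G set0.
  by split => //; rewrite indic0; have [] := bounded_closure_cst m bG 0.
split => //; last exact: closure_sets_bigcup.
by move=> A cA; rewrite setTD; exact: closure_setsC.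
Qed.

Hypothesis closure_measurable : forall A, measurable A -> closure_sets m G A.

Lemma L2_closureZ c f : L2_closure m G f -> L2_closure m G (fun x => c * f x).
Proof.
move=> [sf cf]; split; first exact: sq_integrableZ.
move=> e e0; have c2 : 0 < c ^+ 2 + 1 by rewrite ltr_wpDl ?sqr_ge0.
have [g Gg fg] := cf _ (divr_gt0 e0 c2).
exists (fun x => c * g x); first by apply: gen_algebraM => //; exact: gen_algebra_cst.
have sfg := sq_integrableB sf (gen_algebra_sq m bG Gg).
rewrite (_ : (fun x => _) = fun x => c * (f x - g x)); last first.
  by apply/funext => x; rewrite mulrBr.
rewrite (dotZr _ (sq_integrableZ c sfg) sfg) dotC (dotZr _ sfg sfg) mulrA -expr2.
rewrite ltr_pdivlMr// in fg; apply: le_lt_trans fg.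
by rewrite [leRHS]mulrC ler_wpM2r ?dot_ge0// lerDl.
Qed.

Lemma L2_closure_sum I (s : seq I) (F : I -> T -> R) :
  (forall i, L2_closure m G (F i)) -> L2_closure m G (fun x => \sum_(i <- s) F i x).
Proof.
move=> cF; elim: s => [|i s IH].
  by under eq_fun do rewrite big_nil; have [] := bounded_closure_cst m bG 0.
by under eq_fun do rewrite big_cons; exact: L2_closureD.
Qed.

Import HBNNSimple.

(** Increasing simple functions converge to [f] and are dominated by [f] itself; each is a finite
    combination of indicators already in the closure. *)
Lemma L2_closure_ge0 (f : T -> R) : (forall x, 0 <= f x) ->
  sq_integrable m f -> L2_closure m G f.
Proof.
move=> f0 sf; have [mf _] := sf.
have mEf : measurable_fun [set: T] (EFin \o f) by exact/measurable_EFinP.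
pose u n : {nnsfun T >-> R} := nnsfun_approx measurableT mEf n.
have uf x : u n x @[n --> \oo] --> f x.
  have : (EFin \o (fun n => u n x)) @ \oo --> (EFin \o f) x.
    by apply: (@cvg_nnsfun_approx _ _ _ _ _ _ mEf) => // y _; rewrite lee_fin.
  by move/fine_cvg.
have ule n x : u n x <= f x.
  rewrite -(cvg_lim _ (uf x))//; apply: (@nondecreasing_cvgn_le _ (u^~ x)).
    by move=> i j ij; apply/lefP; exact: nd_nnsfun_approx.
  by apply/cvg_ex; exists (f x); exact: uf.
apply: (L2_closure_dominated bG (u := fun n => u n : T -> R) (h := f) _ sf _ uf); last first.
  by move=> n x; rewrite ger0_norm.
move=> n; rewrite (_ : (u n : T -> R) = fun x => \sum_(i < #|` fset_set (range (u n))|)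
   ((fset_set (range (u n)))`_i * \1_(u n @^-1` [set (fset_set (range (u n)))`_i]) x)); last first.
  by apply/funext => x; rewrite [LHS]fimfunEord.
apply: L2_closure_sum => i; apply: L2_closureZ.
exact: (closure_measurable _).2.
Qed.

Lemma L2_closure_full (f : T -> R) : sq_integrable m f -> L2_closure m G f.
Proof.
move=> sf; have [mf _] := sf.
rewrite (_ : f = fun x => f^\+ x + (-1) * f^\- x); last first.
  by apply/funext => x; rewrite mulN1r -[LHS](congr1 (@^~ x) (funrposBneg f)).
apply: L2_closureD => //; last apply: L2_closureZ.
- apply: L2_closure_ge0 => //; apply: sq_integrable_le sf; first exact: measurable_funrpos.
  move=> x; rewrite ger0_norm ?funrpos_ge0// /funrpos ge_max normr_ge0 andbT ler_norm//.
- apply: L2_closure_ge0 => //; apply: sq_integrable_le sf; first exact: measurable_funrneg.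
  by move=> x; rewrite ger0_norm ?funrneg_ge0// /funrneg ge_max normr_ge0 andbT -normrN ler_norm.
Qed.

End closure_full.

Section closure_product.
Context {R : realType} (m : probability (R * R)%type R).
Variable G : set (R * R -> R).
Hypothesis bG : forall g, G g -> bounded_mfun g.

(** The sets whose preimage under a coordinate lies in [closure_sets] form a sigma-algebra;
    containing the open rays, it contains all Borel sets. Such preimages, for both coordinates,
    generate the product sigma-algebra. *)
Lemma closure_sets_rays : (forall a, closure_sets m G [set w | a < w.1]) ->
  (forall a, closure_sets m G [set w | a < w.2]) ->
  forall A, measurable A -> closure_sets m G A.
Proof.
move=> c1 c2.
have sa := closure_sets_sigma_algebra m bG.
have key (p : R * R -> R) : (forall a, closure_sets m G [set w | a < p w]) ->
    forall B, measurable B -> closure_sets m G (p @^-1` B).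
  move=> cp B mB.
  have {mB} : (@RGenOInfty.G R).-sigma.-measurable B.
    by rewrite -RGenOInfty.measurableE; exact: mB.
  have sI := @sigma_algebra_image _ _ setT p _ sa.
  move/(smallest_sub sI); rewrite /image_set_system/= setTI; apply.
  move=> _ [a ->] /=; rewrite setTI.
  rewrite (_ : _ @^-1` _ = [set w | a < p w])//.
  by apply/seteqP; split => w /=; rewrite in_itv/= andbT.
move=> A; apply: smallest_sub => //.
move=> _ [[B mB <-]|[B mB <-]]; rewrite setTI; exact: key.
Qed.

End closure_product.

(** * Quantile transform and mid-distribution function *)

(** Rational endpoints make the test sets countable: equalities known almost everywhere for each ray
    separately can then be combined outside a single null set. *)
Lemma measure_ext_rays {R : realType} (m1 m2 : {measure set R -> \bar R}) :
  (m1 setT < +oo)%E ->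
  (forall q : rat, m1 `]ratr q, +oo[%classic = m2 `]ratr q, +oo[%classic) ->
  forall A, measurable A -> m1 A = m2 A.
Proof.
move=> m1oo m12 A mA.
pose G := [set B : set R | exists q : rat, B = `]ratr q, +oo[%classic].
apply: (measure_unique G (fun n => `]ratr (- n%:R), +oo[%classic)) => //.
- rewrite eqEsubset; split=> B.
    move=> mB; have : (@RGenOInfty.G R).-sigma.-measurable B.
      by rewrite -RGenOInfty.measurableE; exact: mB.
    apply: smallest_sub; first exact: smallest_sigma_algebra.
    move=> _ [x ->].
    rewrite (_ : `]x, +oo[%classic =
        \bigcup_(q : rat) (if x < ratr q then `]ratr q, +oo[%classic else set0)).
      apply: (@bigcupT_measurable_rat _ (g_sigma_algebraType G)) => q; case: ifPn => _; last exact: measurable0.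
      by apply: sub_sigma_algebra; exists q.
    apply/seteqP; split => y /=.
      rewrite in_itv/= andbT => xy; have [q] := rat_in_itvoo xy.
      by rewrite in_itv/= => /andP[xq qy]; exists q => //; rewrite xq /= in_itv/= qy.
    by move=> [q _]; case: ifPn => //= xq; rewrite !in_itv/= !andbT; exact: lt_trans.
  by apply: smallest_sub; [exact: sigma_algebra_measurable|move=> _ [q ->]; exact: measurable_itv].
- move=> _ _ [p ->] [q ->]; exists (Num.max p q).
  apply/seteqP; split => y /=; rewrite !in_itv/= !andbT.
    by move=> [? ?]; case: (leP p q).
  case: (leP p q) => pq h; split=> //.
    by apply: le_lt_trans h; rewrite ler_rat.
  by apply: lt_trans h; rewrite ltr_rat.
- by move=> n; exists (- n%:R).
- apply/seteqP; split => // y _; exists (Num.bound `|y|) => //=.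
  rewrite in_itv/= andbT rmorphN/= ratr_nat ltrNl.
  by apply: le_lt_trans (archi_boundP (normr_ge0 y)); rewrite -normrN ler_norm.
- by move=> _ [q ->].
- move=> k; apply: le_lt_trans m1oo; apply: le_measure; rewrite ?inE//.
Qed.

Section quantile.
Context {d : measure_display} {Omega : measurableType d} {R : realType}
  {P : probability Omega R}.
Variable Z : {RV P >-> R}.

(** The Galois connection between quantile and distribution function. The limits of the cdf make the
    set in the infimum nonempty and bounded below, and right continuity makes the infimum
    attained. *)
Lemma quantile_le (u z : R) : 0 < u < 1 -> (quantile Z u <= z) = (u%:E <= cdf Z z)%E.
Proof.
move=> /andP[u0 u1]; pose S := [set z | (u%:E <= cdf Z z)%E].
have S0 : S !=set0.
  have : (\forall x \near +oo%R, u%:E < cdf Z x)%E.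
    have /fine_cvg/cvgr_gt/(_ _ u1) := cvg_cdfy1 Z.
    by apply: filterS => x; rewrite -lte_fin fineK ?fin_num_measure.
  by move=> [M [_ /(_ (M + 1))]]; rewrite ltrDl ltr01 => /(_ isT) /ltW; exists (M + 1).
have Slb : has_lbound S.
  have : (\forall x \near -oo%R, cdf Z x < u%:E)%E.
    have /fine_cvg/cvgr_lt/(_ _ u0) := cvg_cdfNy0 Z.
    by apply: filterS => x; rewrite -lte_fin fineK ?fin_num_measure.
  move=> [M [_ Mlt]]; exists (M - 1) => x Sx; rewrite leNgt; apply/negP => xM.
  have := Mlt x; rewrite (lt_trans xM) ?ltrBlDr ?ltrDl// => /(_ isT).
  by rewrite ltNge => /negP; exact.
have Sinf : S (quantile Z u).
  have rc : cdf Z @ (quantile Z u)^'+ --> cdf Z (quantile Z u).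
    exact: cdf_right_continuous.
  apply: (cvge_to_ge rc).
  near=> y; have [z' Sz' z'y] : exists2 z', S z' & z' < y by apply: inf_lt.
  by apply: le_trans Sz' _; apply: cdf_nondecreasing; exact: ltW.
apply/idP/idP => h.
  by apply: le_trans Sinf _; exact: cdf_nondecreasing.
exact: ge_inf.
Unshelve. all: by end_near. Qed.

Lemma cdf_quantile (u : R) : 0 < u < 1 -> (u%:E <= cdf Z (quantile Z u))%E.
Proof. by move=> u01; rewrite -quantile_le. Qed.

(** Made constant outside the open unit interval, where the infimum in [quantile] may be a default
    value, so as to be measurable on the whole line. *)
Definition unit_quantile : measurableTypeR R -> R :=
  quantile Z \_ (`]0, 1[%classic : set R).

Lemma unit_quantileE (u : R) : 0 < u < 1 -> unit_quantile u = quantile Z u.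
Proof. by move=> u01; rewrite /unit_quantile patchE mem_set//= in_itv. Qed.

Lemma measurable_unit_quantile :
  measurable_fun [set: measurableTypeR R] unit_quantile.
Proof.
apply/(measurable_restrictT _ _).1 => //.
apply: (measurability (@RGenOInfty.G R)); first exact: RGenOInfty.measurableE.
move=> _ [_ [a ->] <-].
rewrite (_ : _ `&` _ = `]0, 1[%classic `&` `]fine (cdf Z a), +oo[%classic).
  by apply: measurableI; exact: measurable_itv.
apply/seteqP; split=> u /=; rewrite !in_itv/= !andbT => -[u01 h]; split => //.
  by move: h; rewrite !ltNge quantile_le// -lee_fin fineK ?fin_num_measure.
by move: h; rewrite !ltNge quantile_le// -lee_fin fineK ?fin_num_measure.
Qed.

(** It suffices to compare on rays: Q(u) > a means u > F(a), and the interval from F(a) to 1 has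
    length 1 - F(a). *)
Lemma lebesgue_unit_quantile A : measurable A ->
  lebesgue_measure (unit_quantile @^-1` A `&` `]0, 1[%classic) = distribution P Z A.
Proof.
move=> mA.
have m01 : measurable (`]0, 1[%classic : set (measurableTypeR R)) by exact: measurable_itv.
pose m1' : {measure set R -> \bar R} :=
  pushforward (mrestr (@lebesgue_measure R) m01) unit_quantile.
pose m1 := m1' measurable_unit_quantile.
transitivity (m1 A) => //.
apply: (@measure_ext_rays _ m1 (distribution P Z)) => // [|q].
  rewrite /m1 /m1'/= /pushforward /mrestr preimage_setT setTI.
  by rewrite lebesgue_measure_itv/= lte_fin ltr01 sube0 ltry.
rewrite /m1 /m1' /= /pushforward /mrestr/=.
set a := ratr q.
have F01 : 0 <= fine (cdf Z a) <= 1.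
  by rewrite fine_ge0 ?cdf_ge0//= -lee_fin fineK ?fin_num_measure// cdf_le1.
rewrite (_ : _ `&` _ = `]fine (cdf Z a), 1[%classic); last first.
  apply/seteqP; split => u /=; rewrite !in_itv/= ?andbT.
    move=> [+ u01]; rewrite unit_quantileE// ltNge quantile_le// -ltNge => h.
    case/andP : u01 => _ ->; rewrite andbT.
    by move: h; rewrite -lte_fin fineK ?fin_num_measure.
  move=> /andP[h u1]; have u01 : 0 < u < 1.
    by rewrite u1 andbT; apply: le_lt_trans h; case/andP : F01.
  split=> //; rewrite unit_quantileE// ltNge quantile_le// -ltNge.
  by move: h; rewrite -lte_fin fineK ?fin_num_measure.
rewrite lebesgue_measure_itv/= lte_fin.
transitivity (1 - cdf Z a)%E; last first.
  by rewrite -ccdf_1_cdf.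
case: ltP => [_|]; first by rewrite EFinN fineK ?fin_num_measure.
case/andP : F01 => _ h1 h2; have : fine (cdf Z a) = 1 by apply/eqP; rewrite eq_le h1.
by move=> h; rewrite -[cdf Z a]fineK ?fin_num_measure// h subee.
Qed.

End quantile.

Lemma expectationE {d} {T : measurableType d} {R : realType}
  (P : probability T R) (f : T -> R) : 'E_P[f]%E = (\int[P]_w (f w)%:E)%E.
Proof. by rewrite unlock. Qed.

Section Fmid.
Context {d : measure_display} {Omega : measurableType d} {R : realType}
  {P : probability Omega R}.
Variable Z : {RV P >-> R}.
Local Notation mu := (distribution P Z).

Lemma pmfE (z : R) : (pmf Z z)%:E = mu [set z].
Proof. by rewrite /pmf fineK// fin_num_measure. Qed.

Lemma cdf_add_pmf (a z : R) : a < z ->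
  fine (cdf Z a) + pmf Z z <= fine (cdf Z z).
Proof.
move=> az; rewrite -lee_fin EFinD pmfE !fineK ?fin_num_measure//.
rewrite /cdf -measureU//; last first.
  apply/seteqP; split => // x /= [+ xz]; rewrite xz in_itv/= => /(lt_le_trans az).
  by rewrite ltxx.
apply: le_measure; rewrite ?inE//; first exact: measurableU.
move=> x /= [|->]; rewrite !in_itv/= => // xa; exact: le_trans (ltW az).
Qed.

Lemma pmf_le_cdf (z : R) : pmf Z z <= fine (cdf Z z).
Proof.
rewrite -lee_fin pmfE !fineK ?fin_num_measure//.
by apply: le_measure; rewrite ?inE// => x -> /=; rewrite in_itv/= lexx.
Qed.

Lemma Fmid_ge (a z : R) : a < z -> fine (cdf Z a) + pmf Z z / 2 <= Fmid Z z.
Proof. by move=> /cdf_add_pmf; rewrite /Fmid; lra. Qed.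

Lemma Fmid_nondecreasing : nondecreasing_fun (Fmid Z).
Proof.
move=> a z; rewrite le_eqVlt => /predU1P[->//|/Fmid_ge].
by have := pmf_ge0 Z a; have := pmf_ge0 Z z; rewrite {2}/Fmid; lra.
Qed.

Lemma Fmid_itv (z : R) : 0 <= Fmid Z z <= 1.
Proof.
have := pmf_le_cdf z; have := pmf_ge0 Z z.
have : fine (cdf Z z) <= 1 by rewrite -lee_fin fineK ?fin_num_measure// cdf_le1.
by rewrite /Fmid; lra.
Qed.

Lemma bounded_Fmid : bounded_mfun (Fmid Z).
Proof.
split; first by apply: nondecreasing_measurable => //; exact: Fmid_nondecreasing.
by exists 1 => z; have /andP[? ?] := Fmid_itv z; rewrite ger0_norm.
Qed.

(* The quantile transform never takes values in the flat part of the cdf. *)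
Lemma cdf_flat_null (a : R) :
  mu.-negligible [set z | a < z /\ fine (cdf Z z) = fine (cdf Z a)].
Proof.
set C := [set z | _].
have mC : measurable C.
  rewrite (_ : C = `]a, +oo[%classic `&`
      (fine \o cdf Z) @^-1` [set fine (cdf Z a)]); last first.
    by apply/seteqP; split => x /=; rewrite in_itv/= andbT.
  apply: measurableI => //; rewrite -[X in measurable X]setTI.
  apply: (measurableT_comp _ (cdf_measurable Z)) => //.
apply/negligibleP => //.
apply: etrans (esym (lebesgue_unit_quantile Z mC)) _.
rewrite (_ : _ `&` _ = set0) ?measure0//.
apply/seteqP; split => // u /= [+ u01]; rewrite in_itv/= in u01.
rewrite /C/= unit_quantileE// => -[+ h]; rewrite ltNge => /negP; apply.
rewrite quantile_le//; apply: le_trans (cdf_quantile Z u01) _.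
by rewrite -[leLHS]fineK ?fin_num_measure// h fineK ?fin_num_measure.
Qed.

(** If a < z but Fmid(z) <= Fmid(a), then [Fmid_ge] gives F(a) + p(z)/2 <= F(a) - p(a)/2. Both point
    masses vanish, F(z) = F(a), and z lies in the null set of [cdf_flat_null]. *)
Lemma Fmid_lt_ae (a : R) : {ae mu, forall z, (Fmid Z a < Fmid Z z) = (a < z)}.
Proof.
apply: negligibleS (cdf_flat_null a) => z /= h.
have [az|za] := ltP a z; last first.
  exfalso; apply: h; rewrite ltNge (Fmid_nondecreasing za)/=.
  by rewrite ltNge za.
split=> //; have := Fmid_ge az; rewrite az in h.
have Fza : Fmid Z z <= Fmid Z a by rewrite leNgt; apply/negP => h'; apply: h.
move: Fza; rewrite /Fmid; have := pmf_ge0 Z a; have := pmf_ge0 Z z; lra.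
Qed.

Hypothesis ndZ : nondegenerate_RV Z.

(** Were [Fmid Z] almost everywhere constant, the truth of a < z would not depend on z for almost
    every z, so the cdf would take only the values 0 and 1. All quantiles would then equal the
    median, and the law would be a point mass there. *)
Lemma Fmid_not_ae_cst (c : R) : ~ {ae mu, forall z, Fmid Z z = c}.
Proof.
move=> Fc.
have alt (a : R) : {ae mu, forall z, (a < z) = (Fmid Z a < c)}.
  by apply: filterS2 Fc (Fmid_lt_ae a) => z /= <- ->.
have cdf01 (a : R) : cdf Z a = (if (Fmid Z a < c)%R then 0 else 1)%E.
  case: ifPn => ac.
    apply/negligibleP => //; apply: negligibleS (alt a) => z /=.
    by rewrite in_itv/= ac leNgt => /negP.
  rewrite cdf_1_ccdf (_ : ccdf Z a = 0)%E ?sube0//.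
  apply/negligibleP => //; apply: negligibleS (alt a) => z /=.
  by rewrite in_itv/= andbT => -> /esym; apply/negP.
have h01 : 0 < (2^-1 : R) < 1 by lra.
pose q := quantile Z 2^-1.
have Fq : cdf Z q = 1%E.
  have := cdf_quantile Z h01; rewrite -/q cdf01; case: ifPn => [_|//].
  by rewrite lee_fin => h; exfalso; lra.
apply: (ndZ (c := q)).
apply: etrans (esym (lebesgue_unit_quantile Z (measurable_set1 q))) _.
rewrite (_ : _ `&` _ = `]0, 1[%classic).
  by rewrite lebesgue_measure_itv/= lte_fin ltr01 sube0.
apply/seteqP; split => u /=; rewrite in_itv/=; first by case.
move=> u01; split => //; rewrite unit_quantileE//.
apply/eqP; rewrite eq_le quantile_le// Fq lee_fin (ltW (andP u01).2)/=.
rewrite /q quantile_le//; have := cdf_quantile Z u01; rewrite cdf01.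
case: ifPn => _; rewrite lee_fin => h; last by rewrite lee_fin; lra.
by exfalso; case/andP: u01; lra.
Qed.

(** A zero variance would make [Fmid Z] almost everywhere constant. Hence the denominator of
    [LP_score1] is a true divisor, and [Fmid] can be recovered from the score. *)
Lemma Fmid_std_gt0 : 0 < Num.sqrt (fine 'V_P[Fmid Z \o Z]).
Proof.
pose g w : R := Fmid Z (Z w) - fine 'E_P[Fmid Z \o Z].
have -> : fine 'V_P[Fmid Z \o Z] = dot P g g.
  rewrite /variance covariance.unlock; exact: (congr1 fine (expectationE P _)).
have [mF _] := bounded_Fmid.
have bg : bounded_mfun g.
  apply: bounded_mfunB; last exact: bounded_mfun_cst.
  split; first exact: measurableT_comp.
  by have [_ [M FM]] := bounded_Fmid; exists M.
rewrite sqrtr_gt0 lt_neqAle dot_ge0 andbT eq_sym; apply/eqP.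
move/(dot_eq0_ae (bounded_sq_integrable P bg)) => g0.
apply: (@Fmid_not_ae_cst (fine 'E_P[Fmid Z \o Z])).
have mN : measurable [set z | Fmid Z z != fine 'E_P[Fmid Z \o Z]].
  rewrite (_ : [set z | _] = Fmid Z @^-1` (~` [set fine 'E_P[Fmid Z \o Z]])).
    by rewrite -[X in measurable X]setTI; apply: mF => //; exact: measurableC.
  by apply/seteqP; split => z /= /eqP.
exists [set z | Fmid Z z != fine 'E_P[Fmid Z \o Z]]; split => //.
  rewrite /distribution/= /pushforward; apply/negligibleP.
    by rewrite -[X in measurable X]setTI; exact: measurable_funP.
  apply: negligibleS g0 => w /=; rewrite /g => /eqP h /eqP; rewrite subr_eq0 => /eqP.
  exact: h.
by move=> z /= /eqP.
Qed.

Lemma bounded_LP_score1 : bounded_mfun (LP_score1 Z).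
Proof.
apply: bounded_mfunM; last exact: bounded_mfun_cst.
by apply: bounded_mfunB; [exact: bounded_Fmid|exact: bounded_mfun_cst].
Qed.

End Fmid.

(** * Quantile transform on the unit square *)

Section quantile_transform2.
Context {d : measure_display} {Omega : measurableType d} {R : realType}
  {P : probability Omega R}.
Variables X Y : {RV P >-> R}.
Local Notation mXY := (distribution P X \x distribution P Y)%E.

Let phi (w : measurableTypeR R * measurableTypeR R) : R * R :=
  (unit_quantile X w.1, unit_quantile Y w.2).

Let mphi : measurable_fun setT phi.
Proof.
apply/measurable_fun_pair.
- by apply: (measurableT_comp (measurable_unit_quantile X)); exact: measurable_fst.
- by apply: (measurableT_comp (measurable_unit_quantile Y)); exact: measurable_snd.
Qed.

Lemma measurable_unit_square : measurable (@unit_square R).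
Proof. by apply: measurableX; exact: measurable_itv. Qed.

(** Both measures agree on rectangles, where the one-dimensional transform applies to each factor;
    the product measure is determined by these values. *)
Let integral_push (G : R * R -> \bar R) :
  (\int[pushforward (mrestr lebesgue2 measurable_unit_square) phi]_z G z
   = \int[mXY]_z G z)%E.
Proof.
pose m1' : {measure set (R * R) -> \bar R} :=
  pushforward (mrestr lebesgue2 measurable_unit_square) phi.
pose m1 := m1' mphi.
apply: (@eq_measure_integral _ _ _ _ mXY m1) => A mA _.
apply/esym/product_measure_unique => // B C mB mC.
rewrite /m1 /m1' /= /pushforward /mrestr.
rewrite (_ : _ `&` _ = (unit_quantile X @^-1` B `&` `]0, 1[%classic) `*`
   (unit_quantile Y @^-1` C `&` `]0, 1[%classic)); last first.
  by apply/seteqP; split => -[u v] /=; rewrite /unit_square/=; [move=> [[? ?] [? ?]]|move=> [[? ?] [? ?]]].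
have mQ (Z : {RV P >-> R}) D : measurable D ->
    measurable (unit_quantile Z @^-1` D `&` `]0, 1[%classic : set (measurableTypeR R)).
  move=> mD; apply: measurableI; last exact: measurable_itv.
  by rewrite -[X in measurable X]setTI; apply: measurable_unit_quantile.
apply: etrans (product_measure1E _ _ (mQ X _ mB) (mQ Y _ mC)) _.
by congr (_ * _)%E; apply: lebesgue_unit_quantile.
Qed.

Lemma ge0_integral_quantile2 (G : R * R -> \bar R) : measurable_fun setT G ->
  (forall z, 0 <= G z)%E ->
  (\int[lebesgue2]_(w in unit_square) G (quantile X w.1, quantile Y w.2) =
   \int[mXY]_z G z)%E.
Proof.
move=> mG G0.
have mGphi : measurable_fun setT (G \o phi) by exact: measurableT_comp.
transitivity (\int[lebesgue2]_(w in unit_square) (G \o phi) w)%E.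
  apply: eq_integral => -[u v]; rewrite inE => -[/= u01 v01].
  by rewrite /phi/= !unit_quantileE.
transitivity (\int[mrestr lebesgue2 measurable_unit_square]_(w in unit_square) (G \o phi) w)%E.
  apply: eq_measure_integral => A mA Asq.
  by rewrite /= /mrestr setIidl.
transitivity (\int[mrestr lebesgue2 measurable_unit_square]_w (G \o phi) w)%E.
  rewrite [RHS](@ge0_negligible_integral _ _ _ _ _ (~` unit_square))//=.
  - by rewrite setDE setCK setTI.
  - by apply: measurableC; exact: measurable_unit_square.
  - by rewrite /mrestr setICl measure0.
by rewrite -integral_push ge0_integral_pushforward.
Qed.

Lemma integral_quantile2 (G : R * R -> \bar R) : measurable_fun setT G ->
  (\int[lebesgue2]_(w in unit_square) G (quantile X w.1, quantile Y w.2) =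
   \int[mXY]_z G z)%E.
Proof.
move=> mG; rewrite [LHS]integralE [RHS]integralE; congr (_ - _)%E.
- apply: etrans (ge0_integral_quantile2 (measurable_funepos mG) (funepos_ge0 _)).
  by apply: eq_integral => w _; rewrite ?funeposE ?funenegE.
- apply: etrans (ge0_integral_quantile2 (measurable_funeneg mG) (funeneg_ge0 _)).
  by apply: eq_integral => w _; rewrite ?funeposE ?funenegE.
Qed.

End quantile_transform2.

(** * Gram-Schmidt orthonormalization *)

Section ae_span.
Context {d} {T : measurableType d} {R : realType} (m : probability T R).
Variable E : set (T -> R).
Hypothesis bE : forall e, E e -> bounded_mfun e.
Implicit Types f g : T -> R.

(** Passing to an almost everywhere equal function is restricted to bounded representatives, so that
    every element stays bounded. *)
Inductive ae_span : (T -> R) -> Prop :=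
| ae_span0 : ae_span (fun=> 0)
| ae_span_cons c e f : E e -> ae_span f -> ae_span (fun x => c * e x + f x)
| ae_span_ae f g : bounded_mfun g -> {ae m, forall x, g x = f x} ->
    ae_span f -> ae_span g.

Lemma ae_span_bounded f : ae_span f -> bounded_mfun f.
Proof.
elim=> {f} [|c e f Ee _ bf|//]; first exact: bounded_mfun_cst.
apply: bounded_mfunD => //; apply: bounded_mfunM; [exact: bounded_mfun_cst|exact: bE].
Qed.

Lemma ae_spanD f g : ae_span f -> ae_span g -> ae_span (fun x => f x + g x).
Proof.
move=> sf sg; elim: sf => {f} [|c e f Ee _ sfg|f f' bf' ff' _ sfg].
- by under eq_fun do rewrite add0r.
- by under eq_fun do rewrite -addrA; exact: ae_span_cons.
- apply: ae_span_ae sfg.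
    by apply: bounded_mfunD => //; exact: ae_span_bounded.
  by apply: filterS ff' => x ->.
Qed.

Lemma ae_spanZ c f : ae_span f -> ae_span (fun x => c * f x).
Proof.
elim=> {f} [|c' e f Ee _ sf|f f' bf' ff' _ sf].
- by under eq_fun do rewrite mulr0; exact: ae_span0.
- by under eq_fun do rewrite mulrDr mulrA; exact: ae_span_cons.
- apply: ae_span_ae sf.
    by apply: bounded_mfunM => //; exact: bounded_mfun_cst.
  by apply: filterS ff' => x ->.
Qed.

Lemma ae_span_gen e : E e -> ae_span e.
Proof.
move=> Ee; rewrite (_ : e = fun x => 1 * e x + 0); last first.
  by apply/funext => x; rewrite mul1r addr0.
by apply: ae_span_cons => //; exact: ae_span0.
Qed.

Lemma ae_span_sum I (s : seq I) (F : I -> T -> R) :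
  (forall i, ae_span (F i)) -> ae_span (fun x => \sum_(i <- s) F i x).
Proof.
move=> sF; elim: s => [|i s IH].
  by under eq_fun do rewrite big_nil; exact: ae_span0.
by under eq_fun do rewrite big_cons; exact: ae_spanD.
Qed.

End ae_span.

Section gram_schmidt.
Context {d : measure_display} {Omega : measurableType d} {R : realType}
  {P : probability Omega R}.
Variable Z : {RV P >-> R}.
Local Notation mu := (distribution P Z).
Local Notation T1 := (LP_score1 Z).
Local Notation e := (LP_score Z).

Lemma L2_innerE f g : bounded_mfun f -> bounded_mfun g ->
  L2_inner Z f g = dot mu f g.
Proof.
move=> bf bg; have [mfg [M fgM]] := bounded_mfunM bf bg.
rewrite /L2_inner /dot /Rintegral integral_distribution ?expectationE//.
- exact/measurable_EFinP.
- apply: (@bounded_mfun_integrable _ _ _ P (fun w => f (Z w) * g (Z w))).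
  split; last by exists M.
  exact: (measurableT_comp mfg).
Qed.

(** Each list is a prefix of the longer ones, so the recursion on lists becomes a recursion on the
    scores themselves. *)
Lemma LP_score_seqE n : LP_score_seq Z n = [seq e i | i <- iota 0 n].
Proof.
have sz k : size (LP_score_seq Z k) = k by elim: k => //= k IH; rewrite size_rcons IH.
have nthE k i : (i < k)%N -> nth (fun=> 0) (LP_score_seq Z k) i = e i.
  elim: k => // k IH; rewrite ltnS leq_eqVlt => /predU1P[->//|ik].
  by rewrite /= nth_rcons sz ik IH.
apply: (@eq_from_nth _ (fun=> 0)); rewrite ?size_map ?size_iota// sz => i ilt.
by rewrite nthE// (nth_map 0%N) ?size_iota// nth_iota.
Qed.

Definition LP_residual n z : R :=
  T1 z ^+ n - \sum_(0 <= i < n) L2_inner Z (fun z => T1 z ^+ n) (e i) * e i z.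
Local Notation r := LP_residual.

Lemma LP_scoreE n : e n = fun z => r n z / Num.sqrt (L2_inner Z (r n) (r n)).
Proof.
rewrite {1}/LP_score /= nth_rcons.
rewrite LP_score_seqE size_map size_iota ltnn eqxx.
have -> : (fun z => T1 z ^+ n - \sum_(e0 <- [seq e i | i <- iota 0 n])
   L2_inner Z (fun z0 => T1 z0 ^+ n) e0 * e0 z) = r n.
  by apply/funext => z; rewrite /LP_residual big_map /index_iota subn0.
by apply/funext => z; congr (_ / _); rewrite /LP_residual big_map /index_iota subn0.
Qed.

Lemma bounded_LP_score n : bounded_mfun (e n).
Proof.
elim/ltn_ind: n => n IH; rewrite LP_scoreE.
apply: bounded_mfunM; last exact: bounded_mfun_cst.
apply: bounded_mfunB; first exact/bounded_mfunX/bounded_LP_score1.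
(* [bounded_mfun_sum] asks for boundedness at every index, while the induction hypothesis gives it
   below [n] only; hence the cut-off summand. *)
have -> : (fun z => \sum_(0 <= i < n) L2_inner Z (fun z => T1 z ^+ n) (e i) * e i z) =
  (fun z => \sum_(i <- index_iota 0 n)
    (if (i < n)%N then L2_inner Z (fun z => T1 z ^+ n) (e i) * e i z else 0)).
  by apply/funext => z; apply: eq_big_nat => i /andP[_ ->].
apply: bounded_mfun_sum => i; case: (ltnP i n) => ilt; last exact: bounded_mfun_cst.
by apply: bounded_mfunM; [exact: bounded_mfun_cst|exact: IH].
Qed.

Let bT n : bounded_mfun (fun z => T1 z ^+ n).
Proof. exact/bounded_mfunX/bounded_LP_score1. Qed.

Let be i c : bounded_mfun (fun z => c * e i z).
Proof. by apply: bounded_mfunM; [exact: bounded_mfun_cst|exact: bounded_LP_score]. Qed.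

Lemma bounded_LP_residual n : bounded_mfun (r n).
Proof. by apply: bounded_mfunB => //; exact: bounded_mfun_sum. Qed.

Let sq f (bf : bounded_mfun f) := bounded_sq_integrable mu bf.

Lemma dot_LP_residual f n : sq_integrable mu f -> dot mu f (r n) =
  dot mu f (fun z => T1 z ^+ n) -
  \sum_(0 <= i < n) dot mu (fun z => T1 z ^+ n) (e i) * dot mu f (e i).
Proof.
move=> sf; rewrite /LP_residual dotBr//; last 2 first.
- exact: sq.
- by apply: sq; exact: bounded_mfun_sum.
rewrite dot_sumr//; last by move=> i; exact: sq.
congr (_ - _); apply: eq_bigr => i _.
by rewrite dotZr ?L2_innerE//; [exact: bounded_LP_score|apply: sq; exact: bounded_LP_score].
Qed.

(** The second alternative comes from division by 0: a residual of norm 0 is turned into the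
    function that is 0 everywhere, not just almost everywhere. *)
Lemma LP_score_norm n : dot mu (e n) (e n) = 1 \/ e n = fun=> 0.
Proof.
have [r0|r0] := eqVneq (L2_inner Z (r n) (r n)) 0.
  by right; rewrite LP_scoreE r0 sqrtr0 invr0; apply/funext => z; rewrite mulr0.
left; have br := bounded_LP_residual n; rewrite LP_scoreE L2_innerE// in r0 *.
set s := Num.sqrt _.
rewrite (_ : (fun z => r n z / s) = fun z => s^-1 * r n z); last first.
  by apply/funext => z; rewrite mulrC.
have sr := sq br.
rewrite dotZr//; last exact: sq_integrableZ.
rewrite dotC dotZr// mulrA -invfM -expr2 sqr_sqrtr ?dot_ge0//.
by rewrite mulVf.
Qed.

(** Earlier scores are multiples of earlier residuals, hence mutually orthogonal by induction, and
    the subtracted sum meets [e i] only in its own term. That term cancels if [e i] has norm 1; if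
    [e i] is 0, everything vanishes. *)
Lemma LP_residual_orth i n : (i < n)%N -> dot mu (e i) (r n) = 0.
Proof.
elim/ltn_ind: n i => n IH i ilt.
have orth j k : (j < n)%N -> (k < n)%N -> j != k -> dot mu (e j) (e k) = 0.
  wlog jk : j k / (j < k)%N => [hw jn kn|jn kn _].
    by rewrite neq_ltn => /orP[] h; [|rewrite dotC]; apply: hw => //; rewrite ltn_eqF.
  rewrite (LP_scoreE k) (_ : (fun z => _) = fun z => (Num.sqrt (L2_inner Z (r k) (r k)))^-1 * r k z).
    rewrite dotZr ?IH ?mulr0//; apply: sq; [exact: bounded_LP_score|exact: bounded_LP_residual].
  by apply/funext => z; rewrite mulrC.
rewrite dot_LP_residual; last by apply: sq; exact: bounded_LP_score.
rewrite (bigD1_seq i) ?iota_uniq ?mem_index_iota//=.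
rewrite big_nat_cond big1 ?addr0; last first.
  by move=> k /andP[/andP[_ kn] ki]; rewrite orth ?mulr0// eq_sym.
case: (LP_score_norm i) => [->|->]; first by rewrite mulr1 dotC subrr.
by rewrite !(dotC _ (fun=> 0)) !dot0r mulr0 subrr.
Qed.

Lemma LP_score_orth i j : i != j -> dot mu (e i) (e j) = 0.
Proof.
wlog ij : i j / (i < j)%N => [hw|_].
  by rewrite neq_ltn => /orP[] h; [|rewrite dotC]; apply: hw => //; rewrite ltn_eqF.
rewrite (LP_scoreE j) (_ : (fun z => _) = fun z => (Num.sqrt (L2_inner Z (r j) (r j)))^-1 * r j z).
  rewrite dotZr ?LP_residual_orth ?mulr0//; apply: sq; [exact: bounded_LP_score|exact: bounded_LP_residual].
by apply/funext => z; rewrite mulrC.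
Qed.

Lemma LP_score0 : e 0 = fun=> 1.
Proof.
have r0 : r 0 = fun=> 1.
  by apply/funext => z; rewrite /LP_residual big_geq// subr0 expr0.
have b1 : bounded_mfun (fun=> 1 : R) := bounded_mfun_cst 1.
have d1 : dot mu (fun=> 1) (fun=> 1) = 1.
  rewrite /dot Rintegral_cst// mulr1 mul1r.
  by apply: (congr1 fine (y := 1%E)); exact: probability_setT.
by rewrite LP_scoreE r0 L2_innerE// d1 sqrtr1 invr1; apply/funext => z; rewrite mulr1.
Qed.

Lemma LP_score_mean0 j : (0 < j)%N -> dot mu (fun=> 1) (e j) = 0.
Proof. by move=> j0; rewrite -LP_score0 LP_score_orth// eq_sym -lt0n. Qed.

Local Notation span := (ae_span mu (range e)).

Let bre f : range e f -> bounded_mfun f.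
Proof. by move=> [i _ <-]; exact: bounded_LP_score. Qed.

(* A residual of zero norm vanishes almost everywhere only, whence [ae_span]. *)
Lemma LP_residual_eq n : {ae mu, forall z,
  r n z = Num.sqrt (dot mu (r n) (r n)) * e n z}.
Proof.
have br := bounded_LP_residual n.
have [r0|r0] := eqVneq (dot mu (r n) (r n)) 0.
  have := dot_eq0_ae (sq br) r0; apply: filterS => z ->.
  by rewrite r0 sqrtr0 mul0r.
apply: aeW => z; rewrite LP_scoreE L2_innerE// mulrC divfK//.
by rewrite sqrtr_eq0 -ltNge lt_neqAle eq_sym r0 dot_ge0.
Qed.

Lemma LP_power_eq n : (fun z => T1 z ^+ n) = (fun z =>
  r n z + \sum_(0 <= i < n) L2_inner Z (fun z => T1 z ^+ n) (e i) * e i z).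
Proof. by apply/funext => z; rewrite /LP_residual subrK. Qed.

Lemma span_LP_power n : span (fun z => T1 z ^+ n).
Proof.
rewrite [X in span X]LP_power_eq.
apply: (ae_spanD bre); last first.
  by apply: (ae_span_sum bre) => i; apply: (ae_spanZ _); apply: ae_span_gen; exists i.
apply: (ae_span_ae (bounded_LP_residual n) (LP_residual_eq n)).
by apply: ae_spanZ; apply: ae_span_gen; exists n.
Qed.

(** [T1 * e n] is a multiple of [T1 ^+ n.+1] minus a combination of the [T1 * e i] with [i < n], so
    strong induction applies. This stability makes the span absorb multiplication by the whole
    algebra. *)
Lemma span_mul_LP_score1 f : span f -> span (fun z => T1 z * f z).
Proof.
have step n : span (fun z => T1 z * e n z).
  elim/ltn_ind: n => n IH; rewrite LP_scoreE.
  set c := (Num.sqrt _)^-1.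
  rewrite [X in span X](_ : _ = fun z => c * (T1 z ^+ n.+1 +
     \sum_(i < n) (- L2_inner Z (fun z => T1 z ^+ n) (e i)) * (T1 z * e i z))).
    apply: ae_spanZ; apply: (ae_spanD bre); first exact: span_LP_power.
    by apply: (ae_span_sum bre) => i; apply: ae_spanZ; exact: IH.
  apply/funext => z; rewrite mulrA [RHS]mulrC; congr (_ * _).
  rewrite /LP_residual big_mkord mulrBr -exprS; congr (_ + _).
  rewrite mulr_sumr -sumrN; apply: eq_bigr => i _.
  by rewrite mulNr mulrCA.
elim=> {f} [|c e' f [i _ <-] _ sf|f f' bf' ff' _ sf] /=.
- rewrite [X in span X](_ : _ = fun=> 0); first exact: ae_span0.
  by apply/funext => z; rewrite mulr0.
- rewrite [X in span X](_ : _ = fun z => c * (T1 z * e i z) + T1 z * f z).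
    by apply: (ae_spanD bre) => //; exact: ae_spanZ.
  by apply/funext => z; rewrite mulrDr mulrCA.
- apply: ae_span_ae sf; first by apply: bounded_mfunM => //; exact: bounded_LP_score1.
  by apply: filterS ff' => z ->.
Qed.

(** [T1 ^+ i] is [r i] plus earlier scores, and [r i] is almost everywhere a multiple of [e i]; all
    of these are orthogonal to [r n]. *)
Lemma LP_residual_orth_power i n : (i < n)%N ->
  dot mu (r n) (fun z => T1 z ^+ i) = 0.
Proof.
move=> ilt; have br k := sq (bounded_LP_residual k).
have be' k := sq (bounded_LP_score k).
have -> : dot mu (r n) (fun z => T1 z ^+ i) = dot mu (r n) (r i).
  rewrite dot_LP_residual// big_nat big1 ?subr0// => k /andP[_ ki].
  by rewrite (dotC _ (r n)) LP_residual_orth ?mulr0//; exact: ltn_trans ki ilt.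
have [mr _] := br i; have [mrn _] := br n.
rewrite (dot_ae _ _ _ (LP_residual_eq i))//; last first.
  by apply: measurable_funM => //; have [] := be' i.
by rewrite dotZr// (dotC _ (r n)) LP_residual_orth// mulr0.
Qed.

(** A monic polynomial of degree [j] vanishes at [T1] on the support, so [T1 ^+ j] is almost
    everywhere a combination of lower powers. The residual [r j] is orthogonal to these, hence to
    [T1 ^+ j], hence to itself. *)
Lemma LP_score_finite K j : takes_values Z K -> (K <= j)%N -> e j = fun=> 0.
Proof.
move=> [DK D1] Kj; set D := [set z | 0 < pmf Z z] in DK D1.
suff rr : dot mu (r j) (r j) = 0.
  rewrite LP_scoreE L2_innerE ?rr; [|exact: bounded_LP_residual..].
  by rewrite sqrtr0 invr0; apply/funext => z; rewrite mulr0.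
have finD : finite_set D by exists K.
pose D' := fset_set D.
have cD : #|` D'| = K by exact: card_fset_set.
(* The power of ['X] raises the degree from [K] to exactly [j]. *)
pose p : {poly R} := \prod_(z <- D') ('X - (T1 z)%:P) * 'X^(j - K).
have pm : p \is monic by rewrite monicMr ?monicXn// monic_prod_XsubC.
have sp : size p = j.+1.
  rewrite size_Mmonic ?monicXn ?monic_neq0 ?monic_prod_XsubC// size_prod_XsubC size_polyXn.
  by rewrite -[size D']/(#|` D'|) cD addnS/= addSn subnKC.
have p0 : {ae mu, forall z, p.[T1 z] = 0}.
  exists (~` D); split.
  - exact/measurableC/countable_measurable/finite_set_countable.
  - rewrite probability_setC; last exact/countable_measurable/finite_set_countable.
    by rewrite [X in (1 - X)%E]D1 subee.
  - move=> z /= nz Dz; apply: nz; rewrite hornerM; apply/eqP; rewrite mulf_eq0.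
    apply/orP; left; rewrite horner_prod prodf_seq_eq0; apply/hasP; exists z.
      by rewrite in_fset_set// inE.
    by rewrite /= hornerXsubC subrr.
have pE z : p.[T1 z] = \sum_(i < j) p`_i * T1 z ^+ i + T1 z ^+ j.
  rewrite horner_coef sp big_ord_recr/=; congr (_ + _).
  by move/monicP: pm; rewrite /lead_coef sp/= => ->; rewrite mul1r.
have bp : bounded_mfun (fun z => \sum_(i < j) p`_i * T1 z ^+ i).
  by apply: bounded_mfun_sum => i; apply: bounded_mfunM => //; exact: bounded_mfun_cst.
have br := bounded_LP_residual j.
have -> : dot mu (r j) (r j) = dot mu (r j) (fun z => T1 z ^+ j).
  rewrite [LHS]dot_LP_residual; last exact: sq.
  rewrite big_nat big1 ?subr0// => k /andP[_ kj].
  by rewrite (dotC _ (r j)) LP_residual_orth ?mulr0.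
have sum0 : dot mu (r j) (fun z => \sum_(i < j) p`_i * T1 z ^+ i) = 0.
  rewrite dot_sumr; first last.
  - by move=> i; apply: sq; apply: bounded_mfunM => //; exact: bounded_mfun_cst.
  - exact: sq.
  apply: big1 => i _; rewrite dotZr; [|exact: sq..].
  by rewrite LP_residual_orth_power ?mulr0.
have : dot mu (r j) (fun z => \sum_(i < j) p`_i * T1 z ^+ i + T1 z ^+ j) = 0.
  apply: etrans (dot0r mu (r j)).
  apply: (dot_ae (bounded_mfunD bp (bT j)).1 (measurable_cst _) br.1).
  by apply: filterS p0 => z; rewrite pE.
by rewrite dotDr; [rewrite sum0 add0r|exact: sq..].
Qed.

End gram_schmidt.

(** * Density of the joint law *)

(** By uniqueness of densities, [f] agrees almost everywhere with the Radon-Nikodym derivative, for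
    which the change of variables is known. *)
Lemma ge0_integral_density {R : realType} (nu : probability R R) (f : R -> R) :
  measurable_fun setT f -> (forall z, 0 <= f z) ->
  (forall A, measurable A ->
    nu A = (\int[@lebesgue_measure R]_(z in A) (f z)%:E)%E) ->
  forall (h : R -> \bar R) E, measurable_fun setT h -> (forall z, 0 <= h z)%E ->
    measurable E ->
  (\int[nu]_(z in E) h z = \int[@lebesgue_measure R]_(z in E) (h z * (f z)%:E))%E.
Proof.
move=> mf f0 nuE h E mh h0 mE.
(* The identity carries [nu] over to the measurable type on which Lebesgue measure lives. *)
pose idR : R -> measurableTypeR R := idfun.
have midR : measurable_fun setT idR by move=> _ B mB; rewrite setTI; exact: mB.
pose idRV : {mfun R >-> measurableTypeR R} := mfun_Sub (mem_set midR).
pose nu' : probability (measurableTypeR R) R := distribution nu idRV.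
have mf' : measurable_fun [set: measurableTypeR R] (EFin \o f).
  by apply/measurable_EFinP; exact: mf.
have mh' : measurable_fun [set: measurableTypeR R] h by exact: mh.
have mE' : measurable (E : set (measurableTypeR R)) by exact: mE.
have nuleb : nu' `<< (@lebesgue_measure R).
  apply/null_content_dominatesP => A mA A0.
  rewrite [LHS](nuE A mA); apply: null_set_integral => //.
  exact: measurable_funTS.
pose g := Radon_Nikodym_SigmaFinite.f nu' (@lebesgue_measure R).
have ig := Radon_Nikodym_SigmaFinite.f_integrable nuleb.
have gf : ae_eq (@lebesgue_measure R) setT g (EFin \o f).
  apply: integral_ae_eq => // A _ mA.
  by rewrite -Radon_Nikodym_SigmaFinite.f_integral// -(nuE A mA).
transitivity (\int[nu']_(z in E) h z)%E.
  have h0' : {in E, forall z, 0 <= h z}%E by [].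
  exact: (esym (ge0_integral_pushforward midR nu mE' (measurable_funTS mh') h0')).
rewrite -(Radon_Nikodym_SigmaFinite.change_of_variables nuleb h0 mE'); last exact: measurable_funTS.
have mhg := emeasurable_funM mh' (measurable_int _ ig).
have mhf := emeasurable_funM mh' mf'.
apply: ae_eq_integral => //.
- exact: (measurable_funTS mhg).
- exact: (measurable_funTS mhf).
by apply: filterS gf => z gz _ /=; rewrite -/g gz.
Qed.

Section density_measure.
Context {d} {T : measurableType d} {R : realType} (m : {measure set T -> \bar R}).

(** The proofs of measurability and nonnegativity are arguments so that the measure structure can be
    attached to the term itself. *)
Definition density_measure (f : T -> \bar R) of measurable_fun setT f &
  (forall x, (0 <= f x)%E) := fun A => (\int[m]_(x in A) f x)%E.

Variables (f : T -> \bar R) (mf : measurable_fun setT f) (f0 : forall x, (0 <= f x)%E).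

Let dm0 : density_measure mf f0 set0 = 0%E.
Proof. exact: integral_set0. Qed.

Let dm_ge0 A : (0 <= density_measure mf f0 A)%E.
Proof. exact: integral_ge0. Qed.

Let dm_sigma_additive : semi_sigma_additive (density_measure mf f0).
Proof. exact: semi_sigma_additive_nng_induced. Qed.

HB.instance Definition _ := isMeasure.Build _ _ _ (density_measure mf f0)
  dm0 dm_ge0 dm_sigma_additive.

End density_measure.

Section product_law.
Context {d1 d2} {T1 : measurableType d1} {T2 : measurableType d2} {R : realType}.
Variables (m1 : probability T1 R) (m2 : probability T2 R).

(** The product measure gets a name of its own to carry the structure of a probability, which [dot]
    and [sq_integrable] expect. *)
Definition product_law : set (T1 * T2) -> \bar R := (m1 \x m2)%E.

HB.instance Definition _ := Measure.on product_law.

Let product_law_setT : product_law setT = 1%E.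
Proof.
rewrite /product_law -setXTT.
apply: etrans (product_measure1E _ _ measurableT measurableT) _.
by rewrite -[RHS]mule1; congr (_ * _)%E; exact: probability_setT.
Qed.

HB.instance Definition _ := Measure_isProbability.Build _ _ _ product_law
  product_law_setT.

End product_law.

Section section_law.
Context {d : measure_display} {Omega : measurableType d} {R : realType}
  {P : probability Omega R}.
Variables X Y : {RV P >-> R}.
Hypothesis acXY : joint_law X Y `<< (distribution P X \x distribution P Y)%E.
Local Notation mu := (distribution P X).
Local Notation nu := (distribution P Y).

Let mXY : measurable_fun setT (fun w => (X w, Y w)).
Proof. exact/measurable_fun_pair. Qed.

Definition pairRV : {RV P >-> (R * R)%type} := mfun_Sub (mem_set mXY).
Local Notation J := (distribution P pairRV).

Let acJ : J `<< product_law mu nu. Proof. exact: acXY. Qed.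

Definition joint_density : R * R -> \bar R :=
  Radon_Nikodym_SigmaFinite.f J (product_law mu nu).
Local Notation g := joint_density.

Lemma joint_density_ge0 z : (0 <= g z)%E.
Proof. exact: Radon_Nikodym_SigmaFinite.f_ge0. Qed.

Lemma joint_density_fin_num z : g z \is a fin_num.
Proof. exact: Radon_Nikodym_SigmaFinite.f_fin_num. Qed.

Lemma measurable_joint_density : measurable_fun setT g.
Proof. exact: measurable_int (Radon_Nikodym_SigmaFinite.f_integrable acJ). Qed.

Lemma integral_joint_density (h : R * R -> \bar R) :
  measurable_fun setT h -> (forall z, 0 <= h z)%E ->
  (\int[product_law mu nu]_z (h z * g z) = \int[P]_w h (X w, Y w))%E.
Proof.
move=> mh h0; rewrite [LHS](Radon_Nikodym_SigmaFinite.change_of_variables acJ)//.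
by rewrite ge0_integral_distribution.
Qed.

Let mgx x : measurable_fun setT (fun y => g (x, y)).
Proof.
apply: (measurableT_comp measurable_joint_density).
exact: measurable_pair1.
Qed.

Variable kappa : R.-pker R ~> R.
Hypothesis condk : is_conditional_law X Y kappa.

(** For fixed [B], both sides integrate over every [A] to the joint law of [A] times [B], so they
    agree for almost every [x]. The rays with rational endpoint need only countably many null sets,
    and outside their union [measure_ext_rays] reaches all [B] at once. *)
Lemma conditional_law_joint_density : {ae mu, forall x, forall B, measurable B ->
  kappa x B = (\int[nu]_(y in B) g (x, y))%E}.
Proof.
have FE A B x : (\int[nu]_y (g \_ (A `*` B)) (x, y) =
    ((fun x => \int[nu]_(y in B) g (x, y)) \_ A) x)%E.
  rewrite [RHS]patchE; case: ifPn => xA.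
    rewrite [RHS]integral_mkcond; apply: eq_integral => y _.
    rewrite !patchE; congr (if _ then _ else _).
    apply/idP/idP; rewrite !inE/=; first by case.
    by move=> yB; split => //; exact: set_mem.
  apply: integral0_eq => y _; rewrite patchE; case: ifPn => //.
  by rewrite inE => -[/= /mem_set]; rewrite (negbTE xA).
have mgAB A B : measurable A -> measurable B -> measurable_fun setT (g \_ (A `*` B)).
  move=> mA mB; apply/(measurable_restrictT _ _).1; first exact: measurableX.
  apply: measurable_funTS; exact: measurable_joint_density.
have gAB0 A B z : (0 <= (g \_ (A `*` B)) z)%E.
  by apply: erestrict_ge0 => w _; exact: joint_density_ge0.
have rays B : measurable B -> {ae mu, forall x, kappa x B = (\int[nu]_(y in B) g (x, y))%E}.
  move=> mB.
  have mk : measurable_fun setT (kappa ^~ B) by exact: measurable_kernel.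
  have mgB : measurable_fun setT (fun x => \int[nu]_(y in B) g (x, y))%E.
    have := @measurable_fun_fubini_tonelli_F _ _ _ _ _ nu _ (mgAB setT B measurableT mB) (gAB0 setT B).
    by apply: eq_measurable_fun => x _; rewrite /fubini_F FE patch_setT.
  have : ae_eq mu setT (kappa ^~ B) (fun x => \int[nu]_(y in B) g (x, y))%E.
    apply: integral_ae_eq => //.
      apply: (le_integrable _ mk _ (finite_measure_integrable_cst mu 1 measurableT)) => //.
      move=> x _ /=; rewrite normr1 gee0_abs//.
      by rewrite -(@prob_kernel _ _ _ _ _ kappa x) le_measure ?inE.
    move=> A _ mA; rewrite -condk// -[LHS]/(J (A `*` B)).
    rewrite (Radon_Nikodym_SigmaFinite.f_integral acJ); last exact: measurableX.
    rewrite [LHS]integral_mkcond [RHS]integral_mkcond.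
    have fub := @fubini_tonelli1 _ _ _ _ _ mu nu _ (mgAB A B mA mB) (gAB0 A B).
    transitivity (\int[(mu \x nu)%E]_z (g \_ (A `*` B)) z)%E => //.
    rewrite fub.
    by apply: eq_integral => x _; rewrite /fubini_F FE.
  by apply: filterS => x; exact.
(* The rationals are enumerated by their codes; a number that codes no rational imposes nothing. *)
pose Q (n : nat) (x : R) : Prop := if (choice.unpickle n : option rat) is Some q then
    kappa x `]ratr q, +oo[%classic = (\int[nu]_(y in `]ratr q, +oo[%classic) g (x, y))%E
  else True.
have : {ae mu, forall x n, Q n x}.
  apply: ae_foralln => n; rewrite /Q; case: choice.unpickle => [q|]; first exact: rays.
  exact: aeW.
apply: filterS => x Qx B mB.
pose m2 : {measure set R -> \bar R} := density_measure nu (mgx x) (fun y => joint_density_ge0 (x, y)).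
apply: (@measure_ext_rays _ (kappa x) m2) => //.
  by rewrite prob_kernel ltry.
by move=> q; have := Qx (choice.pickle q); rewrite /Q choice.pickleK.
Qed.

End section_law.

(** * Pointwise identification of the joint density *)

Lemma countable_null {R : realType} (m : {measure set R -> \bar R}) (C : set R) :
  countable C -> (forall z, C z -> m [set z] = 0%E) -> m.-negligible C.
Proof.
move=> /countable_injP[h hinj] mC.
rewrite (_ : C = \bigcup_n (C `&` h @^-1` [set n])); last first.
  by apply/seteqP; split => [z Cz|z [n _ []]//]; exists (h z).
apply: negligible_bigcup => n.
have [[z [Cz hz]]|nz] := pselect (exists z, C z /\ h z = n).
  apply: (@negligibleS _ _ _ m [set z]); last by apply/negligibleP => //; exact: mC.
  move=> y [Cy /= hy]; apply: hinj; rewrite ?inE//.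
  by rewrite hy hz.
rewrite (_ : _ `&` _ = set0); first exact: negligible_set0.
by apply/seteqP; split => // z [Cz /= hz]; apply: nz; exists z.
Qed.

Lemma prob_density_countable {R : realType} (m : set R -> \bar R) (f : R -> R) (C : set R) :
  is_prob_density m f -> countable C -> m C = 0%E.
Proof.
move=> [mf f0 mE] cC.
have mC : measurable (C : set R) by exact: countable_measurable.
rewrite mE//; apply: null_set_integral.
- exact: mC.
- by apply/measurable_EFinP/measurable_funTS; exact: mf.
- exact: countable_lebesgue_measure0.
Qed.

Section density_ratio.
Context {R : realType} (nu : probability R R) (m : {measure set R -> \bar R}).
Variables (gam : R -> \bar R) (f f' : R -> R).
Hypothesis mT : m setT = 1%E.
Hypothesis mgam : measurable_fun setT gam.
Hypothesis gam0 : forall y, (0 <= gam y)%E.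
Hypothesis gam_fin : forall y, gam y \is a fin_num.
Hypothesis mE : forall B, measurable B -> m B = (\int[nu]_(y in B) gam y)%E.

Let m_null N : measurable N -> nu N = 0%E -> m N = 0%E.
Proof.
by move=> mN nN; rewrite mE//; apply: null_set_integral => //; exact: measurable_funTS.
Qed.

Let m_contra C : measurable C -> m C = 0%E -> m (~` C) = 0%E -> False.
Proof.
move=> mC C0 CC0.
have : m (~` C `|` C) = (m (~` C) + m C)%E.
  by apply: measureU => //; [exact: measurableC|exact: setICl].
rewrite setvU mT => e.
have : (1 = 0 :> \bar R)%E by rewrite e C0 adde0; exact: CC0.
by move/eqP; rewrite onee_eq0.
Qed.

Let ratio_from_product :
  {ae nu, forall y, (gam y * (f y)%:E)%E = (f' y)%:E} ->
  {ae nu, forall y, f y <> 0} ->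
  {ae nu, forall y, gam y = (f' y / f y)%:E}.
Proof.
apply: filterS2 => y + fy; rewrite -[gam y]fineK// -EFinM => -[<-].
by rewrite mulfK//; exact/eqP.
Qed.

Let countable_meas (C : set R) : countable C -> measurable C.
Proof. by move=> cC; exact: countable_measurable. Qed.

(** Applied with [m] the conditional law at a fixed x. In the discrete case, evaluation at
    singletons gives [gam * f = f']; in the continuous case, both sides of this equation are
    Lebesgue densities of [m]. Mixed cases are impossible: as [m] is dominated by [nu], some
    countable set and its complement would both be null for [m]. *)
Lemma density_ratio : is_density nu f -> is_density m f' ->
  {ae nu, forall y, gam y = (f' y / f y)%:E}.
Proof.
move=> [[[C [cC nC]] nuf]|df] [[[C' [cC' mC']] mf']|df'].
- apply: ratio_from_product.
    apply: aeW => y; rewrite -mf' mE// -nuf.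
    rewrite (eq_integral (cst (gam y))); last by move=> z; rewrite inE => ->.
    by rewrite integral_cst.
  (* [C] carries all the mass, and within it the zeros of [f] are countably many points of mass
     0. *)
  have nD : nu.-negligible (~` C `|` C `&` [set y | f y = 0]).
    apply: negligibleU.
      by apply/negligibleP => //; apply: measurableC; exact: countable_measurable.
    apply: countable_null; first exact: sub_countable (subset_card_le (@subIsetl _ _ _)) cC.
    by move=> z [_ /= fz]; rewrite nuf fz.
  apply: negligibleS nD => y /= /contrapT fy.
  by have [Cy|Cy] := pselect (C y); [right|left].
- exfalso; apply: (m_contra (countable_meas cC)).
    exact: prob_density_countable df' cC.
  by apply: m_null => //; apply: measurableC; exact: countable_measurable.
- exfalso; apply: (m_contra (countable_meas cC')) => //.
  apply: m_null; first exact: countable_measurable.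
  exact: prob_density_countable df cC'.
- have [mf f0 nuE] := df; have [mf1 f'0 m1E] := df'.
  apply: ratio_from_product.
    have mEf : measurable_fun [set: measurableTypeR R] (fun y => (f y)%:E).
      by apply/measurable_EFinP; exact: mf.
    have mEf' : measurable_fun [set: measurableTypeR R] (fun y => (f' y)%:E).
      by apply/measurable_EFinP; exact: mf1.
    have mg' : measurable_fun [set: measurableTypeR R] gam by exact: mgam.
    have : ae_eq (@lebesgue_measure R) setT (fun y => (f' y)%:E) (fun y => gam y * (f y)%:E)%E.
      apply: integral_ae_eq => //.
      - apply/integrableP; split=> //.
        under eq_integral do rewrite /= ger0_norm//.
        have := m1E setT measurableT; rewrite mT => <-; exact: ltry.
      - exact: emeasurable_funM.
      - move=> A _ mA; rewrite -(m1E A mA) (mE mA).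
        exact: (ge0_integral_density mf f0 nuE).
    (* A set that is null for Lebesgue measure is null for [nu], which has a density. *)
    move=> [N [mN N0 NP]]; exists N; split.
    - exact: mN.
    - rewrite (nuE N mN); apply: null_set_integral => //; exact: measurable_funTS.
    - by move=> y /= h; apply: NP => /= h'; apply: h; rewrite h'.
  have mN : measurable [set y | f y = 0].
    by rewrite -[X in measurable X]setTI; exact: (mf measurableT [set 0]).
  apply: (negligibleS (B := ~` [set y | f y <> 0]) (A := [set y | f y = 0])).
    by move=> y /= /contrapT.
  apply/negligibleP => //; apply: etrans (nuE _ mN) _.
  by apply: integral0_eq => y /= ->.
Qed.

End density_ratio.

(** Inversion is monotone on each side of 0 only, so the preimage of a ray is an interval on each
    side, together with the point 0 if [a < 0], since [0^-1 = 0]. *)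
Lemma measurable_inv {R : realType} : measurable_fun [set: R] (fun x : R => x^-1).
Proof.
apply: (measurability (@RGenOInfty.G R)); first exact: RGenOInfty.measurableE.
move=> _ [_ [a ->] <-]; rewrite setTI.
rewrite (_ : _ @^-1` _ = [set x | 0 < x /\ a < x^-1] `|` [set x | x < 0 /\ a < x^-1]
    `|` (if a < 0 then [set 0] else set0)).
  apply: measurableU; first apply: measurableU.
  - apply: is_interval_measurable => x y /= [x0 ax] [y0 ay] z /andP[xz zy].
    have z0 := lt_le_trans x0 xz; split => //; apply: (lt_le_trans ay).
    by rewrite lef_pV2.
  - apply: is_interval_measurable => x y /= [x0 ax] [y0 ay] z /andP[xz zy].
    have z0 := le_lt_trans zy y0; split => //; apply: (lt_le_trans ay).
    by rewrite lef_nV2.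
  - by case: ifPn.
apply/seteqP; split => x /=; rewrite in_itv/= andbT.
  have [x0 ax|x0 ax|-> ] := ltgtP x 0.
  - by left; right.
  - by left; left.
  - by rewrite invr0 => ->; right.
by move=> [[[]//|[]//]|]; case: ifPn => //= a0 ->; rewrite invr0.
Qed.

Lemma measurable_density {R : realType} (m : probability R R) (f : R -> R) :
  is_density m f -> measurable_fun setT f.
Proof.
case=> [[_ mf]|[]//].
pose idR : {mfun R >-> R} := mfun_Sub (mem_set (@measurable_id _ R setT)).
rewrite (_ : f = pmf (P := m) idR); first exact: pmf_measurable.
by apply/funext => z; rewrite /pmf preimage_id mf.
Qed.

Section copula.
Context {d : measure_display} {Omega : measurableType d} {R : realType}
  {P : probability Omega R}.
Variables X Y : {RV P >-> R}.
Variables (fY : R -> R) (fYX : R -> R -> R).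
Hypothesis hfY : is_density (distribution P Y) fY.
Hypothesis acXY : joint_law X Y `<< (distribution P X \x distribution P Y)%E.
Hypothesis hfYX : is_conditional_density X Y fYX.
Local Notation mu := (distribution P X).
Local Notation nu := (distribution P Y).

(** The copula density before the substitution x = Q(u;X), y = Q(v;Y). *)
Definition density_quotient (z : R * R) := fYX z.1 z.2 / fY z.2.
Local Notation k := density_quotient.

Lemma measurable_density_quotient : measurable_fun setT k.
Proof.
have [mf _] := hfYX.
apply: measurable_funM; first exact: mf.
apply: (measurableT_comp measurable_inv).
apply: (measurableT_comp (measurable_density hfY)); exact: measurable_snd.
Qed.

(** For almost every x, [density_ratio] makes the section at x of the exceptional set null; the
    product measure integrates the measures of these sections. *)
Lemma joint_density_quotient :
  {ae product_law mu nu, forall z, joint_density X Y z = (k z)%:E}.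
Proof.
have mg := measurable_joint_density acXY.
have mk := measurable_density_quotient.
pose N := [set z | joint_density X Y z != (k z)%:E].
have mN : measurable N.
  by rewrite -[N]setTI; apply: measurable_neqe => //; exact/measurable_EFinP.
exists N; split => //; last by move=> z /= /eqP.
have [_ [kappa [condk dk]]] := hfYX.
rewrite /product_law/= /product_measure1.
rewrite (ae_eq_integral (cst 0%E)) ?integral0//.
- exact: measurable_fun_xsection.
- have ae1 := conditional_law_joint_density acXY condk.
  apply: filterS2 dk ae1 => x dx gx _ /=.
  have mgx : measurable_fun setT (fun y => joint_density X Y (x, y)).
    by apply: (measurableT_comp mg); exact: measurable_pair1.
  have := density_ratio (@prob_kernel _ _ _ _ _ kappa x) mgx
    (fun y => joint_density_ge0 acXY (x, y))
    (fun y => joint_density_fin_num acXY (x, y)) gx hfY dx.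
  move=> ae; apply: measure_negligible; first exact: measurable_xsection.
  apply: negligibleS ae => y /=; rewrite /xsection/= inE /N/= => /eqP.
  by move=> h /= h'; apply: h.
Qed.

Lemma expectation_copula (h : R * R -> \bar R) :
  measurable_fun setT h -> (forall z, 0 <= h z)%E ->
  (\int[product_law mu nu]_z (h z * (k z)%:E) = \int[P]_w h (X w, Y w))%E.
Proof.
move=> mh h0; rewrite -(integral_joint_density acXY mh h0).
have mg := measurable_joint_density acXY.
have mk : measurable_fun setT (fun z => (k z)%:E).
  by apply/measurable_EFinP; exact: measurable_density_quotient.
apply: ae_eq_integral => //.
- exact: emeasurable_funM.
- exact: emeasurable_funM.
- by apply: filterS joint_density_quotient => z -> _.
Qed.

End copula.

(** * Completeness of the product scores *)

Section tensor.
Context {R : realType} (mu nu : probability R R).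
Local Notation m := (product_law mu nu).
Implicit Types f g : R -> R.

Lemma ae_fst (Q : R -> Prop) : {ae mu, forall x, Q x} -> {ae m, forall z, Q z.1}.
Proof.
move=> [N [mN N0 NQ]]; exists (N `*` setT); split.
- exact: measurableX.
- apply: etrans (product_measure1E _ _ mN measurableT) _.
  by rewrite [X in (X * _)%E]N0 mul0e.
- by move=> z /= nQ; split => //; exact: NQ.
Qed.

Lemma ae_snd (Q : R -> Prop) : {ae nu, forall y, Q y} -> {ae m, forall z, Q z.2}.
Proof.
move=> [N [mN N0 NQ]]; exists (setT `*` N); split.
- exact: measurableX.
- apply: etrans (product_measure1E _ _ measurableT mN) _.
  by rewrite [X in (_ * X)%E]N0 mule0.
- by move=> z /= nQ; split => //; exact: NQ.
Qed.

Lemma bounded_mfun_fst f : bounded_mfun f -> bounded_mfun (fun z : R * R => f z.1).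
Proof.
move=> [mf [M fM]]; split; last by exists M.
by apply: (measurableT_comp mf); exact: measurable_fst.
Qed.

Lemma bounded_mfun_snd f : bounded_mfun f -> bounded_mfun (fun z : R * R => f z.2).
Proof.
move=> [mf [M fM]]; split; last by exists M.
by apply: (measurableT_comp mf); exact: measurable_snd.
Qed.

Lemma bounded_tensor f g : bounded_mfun f -> bounded_mfun g ->
  bounded_mfun (fun z : R * R => f z.1 * g z.2).
Proof.
by move=> bf bg; apply: bounded_mfunM; [exact: bounded_mfun_fst|exact: bounded_mfun_snd].
Qed.

Lemma Rintegral_tensor f g : bounded_mfun f -> bounded_mfun g ->
  \int[m]_z (f z.1 * g z.2) = (\int[mu]_x f x) * (\int[nu]_y g y).
Proof.
move=> bf bg.
have ig := bounded_mfun_integrable nu bg.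
have if_ := bounded_mfun_integrable mu bf.
have ifg := bounded_mfun_integrable m (bounded_tensor bf bg).
rewrite /Rintegral -fineM ?integrable_fin_num//; congr fine.
have fub := @integral12_prod_meas1 _ _ _ _ _ mu nu _ ifg.
apply: etrans (esym fub) _.
have fg : (\int[nu]_y (g y)%:E)%E \is a fin_num by exact: integrable_fin_num.
rewrite -(fineK fg) -integralZr//.
apply: eq_integral => x _; rewrite /fubini_F/= (fineK fg) -integralZl//.
Qed.

Lemma dot_tensor f g f' g' : bounded_mfun f -> bounded_mfun g ->
  bounded_mfun f' -> bounded_mfun g' ->
  dot m (fun z => f z.1 * g z.2) (fun z => f' z.1 * g' z.2)
  = dot mu f f' * dot nu g g'.
Proof.
move=> bf bg bf' bg'; rewrite /dot.
rewrite -(Rintegral_tensor (bounded_mfunM bf bf') (bounded_mfunM bg bg')).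
by apply: eq_Rintegral => z _; rewrite mulrACA.
Qed.

Variables (A B : set (R -> R)).
Hypothesis bA : forall f, A f -> bounded_mfun f.
Hypothesis bB : forall f, B f -> bounded_mfun f.

Definition tensor_set : set (R * R -> R) :=
  [set h | exists f g, [/\ A f, B g & h = fun z => f z.1 * g z.2]].

Lemma tensor_set_bounded h : tensor_set h -> bounded_mfun h.
Proof. by move=> [f [g [Af Bg ->]]]; apply: bounded_tensor; [exact: bA|exact: bB]. Qed.

Lemma ae_span_tensor f g : ae_span mu A f -> ae_span nu B g ->
  ae_span m tensor_set (fun z => f z.1 * g z.2).
Proof.
move=> sf sg; have bg := ae_span_bounded bB sg.
elim: sf => {f} [|c a f Aa sf IH|f f' bf' ff' sf IH].
- rewrite [X in ae_span _ _ X](_ : _ = fun=> 0); first exact: ae_span0.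
  by apply/funext => z; rewrite mul0r.
- rewrite [X in ae_span _ _ X](_ : _ = fun z => c * (a z.1 * g z.2) + f z.1 * g z.2); last first.
    by apply/funext => z; rewrite mulrDl mulrA.
  apply: (ae_spanD tensor_set_bounded) => //; apply: ae_spanZ.
  have ba := bA Aa.
  elim: sg {bg IH} => {g} [|c' b g Bb sg IH|g g' bg' gg' sg IH].
  + rewrite [X in ae_span _ _ X](_ : _ = fun=> 0); first exact: ae_span0.
    by apply/funext => z; rewrite mulr0.
  + rewrite [X in ae_span _ _ X](_ : _ = fun z => c' * (a z.1 * b z.2) + a z.1 * g z.2); last first.
      by apply/funext => z; rewrite mulrDr mulrCA.
    have Es : tensor_set (fun z => a z.1 * b z.2) by exists a, b.
    exact: (ae_span_cons c' Es IH).
  + apply: ae_span_ae IH; first exact: bounded_tensor.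
    by apply: filterS (ae_snd gg') => z ->.
- apply: ae_span_ae IH; first exact: bounded_tensor.
  by apply: filterS (ae_fst ff') => z ->.
Qed.

Lemma ae_span_mul_fst s h : bounded_mfun s ->
  (forall f, A f -> ae_span mu A (fun x => s x * f x)) ->
  ae_span m tensor_set h -> ae_span m tensor_set (fun z => s z.1 * h z).
Proof.
move=> bs sA; elim=> {h} [|c h f [a [b [Aa Bb ->]]] sf IH|f f' bf' ff' sf IH].
- rewrite [X in ae_span _ _ X](_ : _ = fun=> 0); first exact: ae_span0.
  by apply/funext => z; rewrite mulr0.
- rewrite [X in ae_span _ _ X](_ : _ = fun z => c * ((s z.1 * a z.1) * b z.2) + s z.1 * f z); last first.
    by apply/funext => z; rewrite mulrDr; congr (_ + _); rewrite mulrCA; congr (_ * _); rewrite mulrA.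
  apply: (ae_spanD tensor_set_bounded) => //; apply: ae_spanZ.
  by apply: (ae_span_tensor (sA a Aa)); exact: ae_span_gen.
- apply: ae_span_ae IH.
    by apply: bounded_mfunM => //; exact: bounded_mfun_fst.
  by apply: filterS ff' => z ->.
Qed.

Lemma ae_span_mul_snd s h : bounded_mfun s ->
  (forall f, B f -> ae_span nu B (fun x => s x * f x)) ->
  ae_span m tensor_set h -> ae_span m tensor_set (fun z => s z.2 * h z).
Proof.
move=> bs sB; elim=> {h} [|c h f [a [b [Aa Bb ->]]] sf IH|f f' bf' ff' sf IH].
- rewrite [X in ae_span _ _ X](_ : _ = fun=> 0); first exact: ae_span0.
  by apply/funext => z; rewrite mulr0.
- rewrite [X in ae_span _ _ X](_ : _ = fun z => c * (a z.1 * (s z.2 * b z.2)) + s z.2 * f z); last first.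
    by apply/funext => z; rewrite mulrDr; congr (_ + _); rewrite mulrCA; congr (_ * _); rewrite mulrCA.
  apply: (ae_spanD tensor_set_bounded) => //; apply: ae_spanZ.
  by apply: ae_span_tensor (sB b Bb); exact: ae_span_gen.
- apply: ae_span_ae IH.
    by apply: bounded_mfunM => //; exact: bounded_mfun_snd.
  by apply: filterS ff' => z ->.
Qed.

End tensor.

Section LP_density.
Context {d : measure_display} {Omega : measurableType d} {R : realType}
  {P : probability Omega R}.
Variables X Y : {RV P >-> R}.
Hypotheses (ndX : nondegenerate_RV X) (ndY : nondegenerate_RV Y).
Local Notation mu := (distribution P X).
Local Notation nu := (distribution P Y).
Local Notation m := (product_law mu nu).
Local Notation LPset := (tensor_set (range (LP_score X)) (range (LP_score Y))).

Let G : set (R * R -> R) :=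
  [set h | h = (fun z => LP_score1 X z.1) \/ h = (fun z => LP_score1 Y z.2)].

Let bG h : G h -> bounded_mfun h.
Proof.
move=> [->|->].
- by apply: bounded_mfun_fst; exact: bounded_LP_score1.
- by apply: bounded_mfun_snd; exact: bounded_LP_score1.
Qed.

Let brange (Z : {RV P >-> R}) f : range (LP_score Z) f -> bounded_mfun f.
Proof. by move=> [i _ <-]; exact: bounded_LP_score. Qed.

Let bLP : forall h, LPset h -> bounded_mfun h.
Proof. exact: tensor_set_bounded (@brange X) (@brange Y). Qed.

(** The induction proves more: multiplication by [h] preserves the span. This reduces products in
    the algebra to composition, and the claim follows by applying it to 1, the product of the scores
    of index 0. *)
Lemma gen_algebra_LP_span h : gen_algebra G h -> ae_span m LPset h.
Proof.
move=> Gh; suff H f : ae_span m LPset f -> ae_span m LPset (fun z => h z * f z).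
  rewrite (_ : h = fun z => h z * (1 * 1)); last by apply/funext => z; rewrite !mulr1.
  apply: H; apply: (ae_span_tensor (@brange X) (@brange Y) (f := fun=> 1) (g := fun=> 1)).
  - by apply: ae_span_gen; exists 0%N => //; exact: LP_score0.
  - by apply: ae_span_gen; exists 0%N => //; exact: LP_score0.
elim: Gh f => {h} [h [->|->]|c|h h' _ IH _ IH'|h h' _ IH _ IH'] f sf.
- apply: (ae_span_mul_fst (@brange X) (@brange Y)) => //; first exact: bounded_LP_score1.
  by move=> g rg; apply: span_mul_LP_score1; exact: ae_span_gen.
- apply: (ae_span_mul_snd (@brange X) (@brange Y)) => //; first exact: bounded_LP_score1.
  by move=> g rg; apply: span_mul_LP_score1; exact: ae_span_gen.
- exact: ae_spanZ.
- rewrite [X in ae_span _ _ X](_ : _ = fun z => h z * f z + h' z * f z).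
    by apply: (ae_spanD bLP); [exact: IH|exact: IH'].
  by apply/funext => z; rewrite mulrDl.
- rewrite [X in ae_span _ _ X](_ : _ = fun z => h z * (h' z * f z)).
    by apply: IH; exact: IH'.
  by apply/funext => z; rewrite mulrA.
Qed.

Let closure_ray (Z : {RV P >-> R}) (p : R * R -> R) (a : R) : nondegenerate_RV Z ->
  measurable_fun setT p ->
  (forall Q : R -> Prop, {ae distribution P Z, forall x, Q x} -> {ae m, forall z, Q (p z)}) ->
  G (fun z => LP_score1 Z (p z)) -> closure_sets m G [set w | a < p w].
Proof.
move=> ndZ mp aep Gp.
have mA : measurable [set w | a < p w].
  rewrite (_ : [set w | a < p w] = p @^-1` `]a, +oo[%classic).
    by rewrite -[X in measurable X]setTI; apply: mp => //; exact: measurable_itv.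
  by apply/seteqP; split => w /=; rewrite in_itv/= andbT.
split => //.
pose s w := Fmid Z (p w) - Fmid Z a.
have cs : bounded_closure m G s.
  have c1 : bounded_closure m G (fun z => LP_score1 Z (p z)).
    by split; [exact: bG|apply: (L2_closure_alg m bG); exact: gen_algebra_gen].
  (* Undoing the standardization exhibits [Fmid] as an affine function of the score. *)
  rewrite (_ : s = fun z => Num.sqrt (fine 'V_P[Fmid Z \o Z]) * LP_score1 Z (p z)
     + (2^-1 - Fmid Z a)).
    apply: (bounded_closureD bG); last exact: (bounded_closure_cst m bG).
    by apply: (bounded_closureM bG) => //; exact: (bounded_closure_cst m bG).
  apply/funext => z; rewrite /s /LP_score1 mulrC divfK; last first.
    by rewrite gt_eqF//; exact: Fmid_std_gt0.
  by rewrite addrA subrK.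
have s1 w : `|s w| <= 1.
  have /andP[? ?] := Fmid_itv Z (p w); have /andP[? ?] := Fmid_itv Z a.
  by rewrite /s ler_norml; lra.
have bI := bounded_mfun_indic mA : bounded_mfun (\1_[set w | a < p w] : R * R -> R).
apply: (L2_closure_ae bG bI.1 bI _ (L2_closure_gt0 bG cs s1)).
apply: filterS (aep _ (Fmid_lt_ae Z a)) => w h.
rewrite !indicE; congr ((_ : bool)%:R).
by apply/idP/idP; rewrite !inE /s /= subr_gt0 h.
Qed.

Lemma LP_span_dense f : sq_integrable m f -> forall e, 0 < e ->
  exists2 g, ae_span m LPset g &
    dot m (fun z => f z - g z) (fun z => f z - g z) < e.
Proof.
move=> sf e e0.
have rays : forall A, measurable A -> closure_sets m G A.
  apply: (closure_sets_rays bG) => a.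
  - exact: (closure_ray a ndX (@measurable_fst _ _ R R) (@ae_fst _ mu nu) (or_introl erefl)).
  - exact: (closure_ray a ndY (@measurable_snd _ _ R R) (@ae_snd _ mu nu) (or_intror erefl)).
have [_ H] := L2_closure_full bG rays sf.
by have [g Gg fg] := H e e0; exists g => //; exact: gen_algebra_LP_span.
Qed.

(** An element of the span involves finitely many product scores up to null sets; [N] bounds their
    indices and will determine how large the index set of the partial sum must be. *)
Lemma LP_span_orth f : ae_span m LPset f -> exists N, forall r, sq_integrable m r ->
  (forall j k, (j < N)%N -> (k < N)%N ->
    dot m r (fun z => LP_score X j z.1 * LP_score Y k z.2) = 0) ->
  dot m r f = 0.
Proof.
elim=> {f} [|c h f [_ [_ [[j _ <-] [k _ <-] ->]]] sf [N HN]|f f' bf' ff' sf [N HN]].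
- by exists 0%N => r _ _; exact: dot0r.
- exists (maxn N (maxn j.+1 k.+1)) => r sr rE.
  have be : bounded_mfun (fun z : R * R => LP_score X j z.1 * LP_score Y k z.2).
    by apply: bounded_tensor; exact: bounded_LP_score.
  have se := bounded_sq_integrable m be.
  have sf' := bounded_sq_integrable m (ae_span_bounded bLP sf).
  rewrite dotDr//; last exact: sq_integrableZ.
  rewrite dotZr// rE ?mulr0 ?add0r ?leq_max ?leqnn ?orbT//.
  by apply: HN => // i l iN lN; apply: rE; rewrite leq_max ?iN ?lN.
- exists N => r sr rE.
  have [mf _] := ae_span_bounded bLP sf; have [mf' _] := bf'; have [mr _] := sr.
  by rewrite (dot_ae mf' mf mr ff'); exact: HN.
Qed.

End LP_density.

(** * Expansion of the copula density *)

Lemma dot_le_orth {d} {T : measurableType d} {R : realType} (m : probability T R)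
  (r h : T -> R) : sq_integrable m r -> sq_integrable m h -> dot m r h = 0 ->
  dot m r r <= dot m (fun x => r x + h x) (fun x => r x + h x).
Proof.
move=> sr sh rh; have srh := sq_integrableD sr sh.
rewrite dotDr// (dotC _ _ r) dotDr// rh addr0 (dotC _ _ h) dotDr// (dotC _ h r) rh add0r.
by rewrite lerDl dot_ge0.
Qed.

Section copula_expansion.
Context {d : measure_display} {Omega : measurableType d} {R : realType}
  {P : probability Omega R}.
Variables X Y : {RV P >-> R}.
Variables (fY : R -> R) (fYX : R -> R -> R).
Hypotheses (ndX : nondegenerate_RV X) (ndY : nondegenerate_RV Y).
Hypothesis hfY : is_density (distribution P Y) fY.
Hypothesis acXY : joint_law X Y `<< (distribution P X \x distribution P Y)%E.
Hypothesis hfYX : is_conditional_density X Y fYX.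
Local Notation mu := (distribution P X).
Local Notation nu := (distribution P Y).
Local Notation m := (product_law mu nu).
Local Notation k := (density_quotient fY fYX).

Hypothesis sk : sq_integrable m k.

(** [expectation_copula] covers nonnegative functions; adding and subtracting a bound [M] of [h]
    extends it to signed bounded ones. *)
Lemma dot_density_quotient h : bounded_mfun h ->
  dot m h k = \int[P]_w h (X w, Y w).
Proof.
have ge0 (g : R * R -> R) : (forall z, 0 <= g z) -> bounded_mfun g ->
    dot m g k = \int[P]_w g (X w, Y w).
  move=> g0 [mg _]; rewrite /dot /Rintegral.
  have mEg : measurable_fun setT (EFin \o g) by exact/measurable_EFinP.
  have g0' z : (0 <= (EFin \o g) z)%E by rewrite lee_fin.
  by rewrite -(expectation_copula hfY acXY hfYX mEg g0').
have bP (g : R * R -> R) : bounded_mfun g -> bounded_mfun (fun w => g (X w, Y w)).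
  move=> [mg [M gM]]; split; last by exists M.
  by apply: (measurableT_comp mg); exact/measurable_fun_pair.
move=> bh; have [_ [M hM]] := bh.
have M0 : 0 <= M by exact: le_trans (hM (0, 0)).
have bM : bounded_mfun (fun _ : R * R => M : R) := bounded_mfun_cst M.
have bhM := bounded_mfunD bh bM.
have -> : h = (fun z => (h z + M) - M) by apply/funext => z; rewrite addrK.
rewrite dotBl//; try exact: bounded_sq_integrable.
rewrite !ge0//; last first.
  by move=> z; have := hM z; rewrite ler_norml => /andP[? _]; lra.
have i1 := bounded_mfun_integrable P (bP _ bhM).
have i2 := bounded_mfun_integrable P (bP _ bM).
exact: (esym (RintegralB measurableT i1 i2)).
Qed.

Definition LP_product (j l : nat) (z : R * R) := LP_score X j z.1 * LP_score Y l z.2.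
Local Notation e := LP_product.
Local Notation c := (LP_comoment X Y).

Lemma bounded_LP_product j l : bounded_mfun (e j l).
Proof. by apply: bounded_tensor; exact: bounded_LP_score. Qed.

Let se j l : sq_integrable m (e j l).
Proof. exact/bounded_sq_integrable/bounded_LP_product. Qed.

Lemma LP_comomentE j l : c j l = dot m (e j l) k.
Proof.
by rewrite dot_density_quotient; [rewrite /LP_comoment expectationE|exact: bounded_LP_product].
Qed.

Lemma dot_LP_product j l j' l' : dot m (e j l) (e j' l') =
  dot mu (LP_score X j) (LP_score X j') * dot nu (LP_score Y l) (LP_score Y l').
Proof. by apply: dot_tensor; exact: bounded_LP_score. Qed.

Lemma LP_product00 : e 0 0 = fun=> 1.
Proof. by apply/funext => z; rewrite /LP_product !LP_score0 mulr1. Qed.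

Let marginal (Z : {RV P >-> R}) j : (0 < j)%N -> \int[P]_w LP_score Z j (Z w) = 0.
Proof.
move=> j0; rewrite -(LP_score_mean0 Z j0) -L2_innerE; last 2 first.
- exact: bounded_mfun_cst.
- exact: bounded_LP_score.
rewrite /L2_inner expectationE; congr fine.
by apply: eq_integral => w _; rewrite mul1r.
Qed.

(** The (0,0) term of the expansion is the constant 1, and the other terms with a zero index vanish
    because scores of positive index have mean 0. Subtracting 1 from the copula density thus leaves
    the positive indices. *)
Lemma LP_comoment00 : c 0 0 = 1.
Proof.
rewrite LP_comomentE dot_density_quotient; last exact: bounded_LP_product.
rewrite LP_product00 Rintegral_cst// mul1r.
by apply: (congr1 fine (y := 1%E)); exact: probability_setT.
Qed.

Lemma LP_comoment0l l : (0 < l)%N -> c 0 l = 0.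
Proof.
move=> l0; rewrite LP_comomentE dot_density_quotient; last exact: bounded_LP_product.
rewrite -(marginal Y l0); apply: eq_Rintegral => w _.
by rewrite /LP_product LP_score0 mul1r.
Qed.

Lemma LP_comoment0r j : (0 < j)%N -> c j 0 = 0.
Proof.
move=> j0; rewrite LP_comomentE dot_density_quotient; last exact: bounded_LP_product.
rewrite -(marginal X j0); apply: eq_Rintegral => w _.
by rewrite /LP_product LP_score0 mulr1.
Qed.

Lemma LP_score_index (Z : {RV P >-> R}) j : (0 < j)%N -> ~ LP_indices Z j ->
  LP_score Z j = fun=> 0.
Proof.
move=> j0 nj; have [K tK jK] : exists2 K, takes_values Z K & (K <= j)%N.
  apply: contrapT => h; apply: nj; split => // K tK; rewrite ltnNge; apply/negP => Kj.
  by apply: h; exists K.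
exact: LP_score_finite tK jK.
Qed.

Definition LP_remainder (J : {fset nat * nat}) (z : R * R) :=
  k z - 1 - \sum_(jl <- J | jl \in LP_indices X `*` LP_indices Y)
    c jl.1 jl.2 * e jl.1 jl.2 z.
Local Notation r := LP_remainder.

Let scE (jl : nat * nat) : sq_integrable m
  (fun z => if jl \in LP_indices X `*` LP_indices Y
            then c jl.1 jl.2 * e jl.1 jl.2 z else 0).
Proof.
case: (jl \in _); first exact: sq_integrableZ.
exact/bounded_sq_integrable/bounded_mfun_cst.
Qed.

Let sone : sq_integrable m (fun=> 1).
Proof. exact/bounded_sq_integrable/bounded_mfun_cst. Qed.

(** With the condition moved into the summand, every summand is square integrable and the
    unconditional sum lemmas apply. *)
Let rE J : r J = fun z => k z - 1 - \sum_(jl <- J)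
  (if jl \in LP_indices X `*` LP_indices Y then c jl.1 jl.2 * e jl.1 jl.2 z else 0).
Proof. by apply/funext => z; rewrite /LP_remainder big_mkcond. Qed.

Lemma sq_LP_remainder J : sq_integrable m (r J).
Proof.
rewrite rE; apply: sq_integrableB; first exact: sq_integrableB.
exact: sq_integrable_sum.
Qed.

Let dot_rE J f : sq_integrable m f -> dot m f (r J) =
  dot m f k - dot m f (fun=> 1) - \sum_(jl <- J)
  (if jl \in LP_indices X `*` LP_indices Y
   then c jl.1 jl.2 * dot m f (e jl.1 jl.2) else 0).
Proof.
move=> sf; rewrite rE dotBr//; last 2 first.
- exact: sq_integrableB.
- exact: sq_integrable_sum.
rewrite dotBr// dot_sumr//; congr (_ - _); apply: eq_bigr => jl _.
by case: (jl \in _); [rewrite dotZr|rewrite dot0r].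
Qed.

(** If an index is 0, the comoments cancel against the subtracted 1. If both indices are positive
    and exist, the term (j, l) of the partial sum cancels the coefficient of [k]. Otherwise the
    product score is the zero function. *)
Lemma LP_remainder_orth J j l :
  (LP_indices X j -> LP_indices Y l -> (j, l) \in J) ->
  dot m (e j l) (r J) = 0.
Proof.
move=> jlJ; rewrite dot_rE// -LP_comomentE -LP_product00 dot_LP_product.
have zero j' l' : j' != j \/ l' != l -> dot m (e j l) (e j' l') = 0.
  rewrite dot_LP_product => -[] ne.
    by rewrite (LP_score_orth X) ?mul0r// eq_sym.
  by rewrite (LP_score_orth Y) ?mulr0// eq_sym.
have sum0 : j = 0%N \/ l = 0%N -> \sum_(jl <- J)
    (if jl \in LP_indices X `*` LP_indices Y
     then c jl.1 jl.2 * dot m (e j l) (e jl.1 jl.2) else 0) = 0.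
  move=> jl0; apply: big1 => -[j' l'] _ /=; case: ifPn => //.
  rewrite inE => -[[/= j'0 _] [l'0 _]]; rewrite zero ?mulr0//.
  by case: jl0 => ->; [left|right]; rewrite -lt0n.
have norm0 (Z : {RV P >-> R}) : dot (distribution P Z) (LP_score Z 0) (LP_score Z 0) = 1.
  case: (LP_score_norm Z 0) => // /(congr1 (@^~ 0)).
  by rewrite LP_score0 => /eqP; rewrite oner_eq0.
have [j0|j0] := posnP j.
  rewrite sum0; last by left.
  rewrite j0 norm0 mul1r; have [->|l0] := posnP l.
    by rewrite norm0 LP_comoment00 !subrr.
  by rewrite LP_comoment0l// (LP_score_orth Y) ?subrr// -lt0n.
have [l0|l0] := posnP l.
  rewrite sum0; last by right.
  by rewrite l0 LP_comoment0r// (LP_score_orth X) ?mul0r ?subrr// -lt0n.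
rewrite (LP_score_orth X) ?mul0r ?subr0 -?lt0n//.
have [jl|njl] := pselect (LP_indices X j /\ LP_indices Y l).
  rewrite (bigD1_seq (j, l)) ?fset_uniq ?jlJ//=; try by case: jl.
  rewrite mem_set//= big1 ?addr0; last first.
    move=> [j' l'] ne; case: ifPn => // _; rewrite zero ?mulr0//=.
    by move: ne; rewrite xpair_eqE negb_and => /orP.
  rewrite dot_LP_product LP_comomentE.
  (* [LP_score_norm] leaves open that the score of an existing index is 0; then both terms
     vanish. *)
  have e0 : LP_score X j = (fun=> 0) \/ LP_score Y l = (fun=> 0) -> dot m (e j l) k = 0.
    move=> h; rewrite dotC (_ : e j l = fun=> 0) ?dot0r//.
    by apply/funext => z; rewrite /LP_product; case: h => ->; rewrite ?mul0r ?mulr0.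
  case: (LP_score_norm X j) => [->|aj]; last by rewrite e0 ?mul0r ?subrr//; left.
  case: (LP_score_norm Y l) => [->|bl]; last by rewrite e0 ?mul0r ?subrr//; right.
  by rewrite !mulr1 subrr.
have E0 : e j l = fun=> 0.
  apply/funext => z; rewrite /LP_product.
  have [hj|hj] := pselect (LP_indices X j); last by rewrite LP_score_index ?mul0r.
  by rewrite (LP_score_index l0) ?mulr0// => hl; apply: njl.
rewrite LP_comomentE E0 dotC dot0r sub0r big1 ?oppr0// => jl _.
by case: ifPn => // _; rewrite dotC dot0r mulr0.
Qed.

(** Take [f] in the span close to [k]. Once [J] contains the indices of [f], the remainder is
    orthogonal to [f] and to [h], the sum of 1 and the partial sum. As [k - f] is the remainder plus
    [h - f], Pythagoras gives the bound. *)
Lemma LP_remainder_small eps : 0 < eps -> exists J0 : {fset nat * nat},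
  forall J, (J0 `<=` J)%fset -> dot m (r J) (r J) < eps.
Proof.
move=> eps0; have [f spf kf] := LP_span_dense ndX ndY sk eps0.
have [N HN] := LP_span_orth spf.
(* All pairs below [N] are taken; those outside the existing positive indices are filtered out in
   [LP_remainder]. *)
exists [fset jl in [seq (i, l) | i <- iota 0 N, l <- iota 0 N]]%fset => J J0J.
apply: le_lt_trans kf.
have sr := sq_LP_remainder J.
have sf : sq_integrable m f.
  apply: bounded_sq_integrable; apply: (ae_span_bounded _ spf).
  by apply: tensor_set_bounded => _ [i _ <-]; exact: bounded_LP_score.
have rorth j l : (LP_indices X j -> LP_indices Y l -> (j, l) \in J) ->
    dot m (r J) (e j l) = 0.
  by move=> h; rewrite dotC LP_remainder_orth.
have rf : dot m (r J) f = 0.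
  apply: HN => // j l jN lN; apply: rorth => _ _.
  apply: (fsubsetP J0J); rewrite in_fset; apply/allpairsP; exists (j, l).
  by rewrite !mem_iota.
pose h z := 1 + \sum_(jl <- J) (if jl \in LP_indices X `*` LP_indices Y
            then c jl.1 jl.2 * e jl.1 jl.2 z else 0).
have sh : sq_integrable m h by apply: sq_integrableD => //; exact: sq_integrable_sum.
have rh : dot m (r J) h = 0.
  rewrite dotDr//; last exact: sq_integrable_sum.
  rewrite -LP_product00 rorth ?add0r; last by case.
  rewrite dot_sumr//; rewrite big_seq; apply: big1 => -[j l] jlJ.
  case: (_ \in _); last exact: dot0r.
  by rewrite dotZr// rorth ?mulr0.
have -> : (fun z => k z - f z) = (fun z => r J z + (h z - f z)).
  by apply/funext => z; rewrite rE /h; ring.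
apply: dot_le_orth => //; first exact: sq_integrableB.
by rewrite dotBr// rh rf subrr.
Qed.

End copula_expansion.

Theorem theorem6 (d : measure_display) (Omega : measurableType d)
  (R : realType) (P : probability Omega R) (X Y : {RV P >-> R})
  (fY : R -> R) (fYX : R -> R -> R)
  (ndX : nondegenerate_RV X) (ndY : nondegenerate_RV Y)
  (dcX : discrete_or_continuous X)
  (hfY : is_density (distribution P Y) fY)
  (acXY : joint_law X Y `<< (distribution P X \x distribution P Y)%E)
  (hfYX : is_conditional_density X Y fYX)
  (sqcop : lebesgue2.-integrable unit_square
     (fun w => (copula_density X Y fY fYX w.1 w.2 ^+ 2)%:E)) :
  (fun J : {fset nat * nat} =>
    (\int[lebesgue2]_(w in unit_square)
      ((copula_density X Y fY fYX w.1 w.2 - 1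
        - \sum_(jk <- J | jk \in LP_indices X `*` LP_indices Y)
            LP_comoment X Y jk.1 jk.2
            * LP_unit_score X jk.1 w.1 * LP_unit_score Y jk.2 w.2) ^+ 2)%:E)%E)
    @ totally --> 0%E /\
  (forall j k, LP_indices X j -> LP_indices Y k ->
    (\int[lebesgue2]_(w in unit_square)
       (comparison_density Y fY (fYX (quantile X w.1)) w.2
        * LP_unit_score X j w.1 * LP_unit_score Y k w.2)%:E)%E
    = (LP_comoment X Y j k)%:E).
Proof.
pose q := density_quotient fY fYX.
pose m := product_law (distribution P X) (distribution P Y).
have mq : measurable_fun setT q := measurable_density_quotient hfY hfYX.
have sq : sq_integrable m q.
  split=> //; have [_ fin] := integrableP _ _ _ sqcop.
  have mq2 : measurable_fun setT (fun z => (q z ^+ 2)%:E).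
    by apply/measurable_EFinP; exact: measurable_funX.
  apply/integrableP; split => //; apply: le_lt_trans fin.
  (* The quantile transform carries square integrability from the unit square to the product law. *)
  rewrite -(ge0_integral_quantile2 X Y (G := fun z => `|(q z ^+ 2)%:E|%E))//.
  exact: measurableT_comp.
split.
  (* The integral over the square is the squared norm of the remainder under the product law, a
     finite number, so that the limit can be taken in the reals. *)
  pose D J := dot m (LP_remainder X Y fY fYX J) (LP_remainder X Y fY fYX J).
  rewrite (_ : (fun J => _) = EFin \o D); last first.
    apply/funext => J; have sr := sq_LP_remainder sq J.
    rewrite /= /D /dot /Rintegral fineK; last first.
      by apply: integrable_fin_num => //; exact: sq_integrableM.
    rewrite -(ge0_integral_quantile2 X Y
      (G := fun z => (LP_remainder X Y fY fYX J z * LP_remainder X Y fY fYX J z)%:E)).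
    - apply: eq_integral => w _; rewrite expr2; congr (_ * _)%:E;
      by rewrite /LP_remainder; congr (_ - _); apply: eq_bigr => jl _; rewrite /LP_product mulrA.
    - by have [mr _] := sr; apply/measurable_EFinP; exact: measurable_funM.
    - by move=> z; rewrite lee_fin -expr2 sqr_ge0.
  have TF : ProperFilter (@totally (nat * nat)%type) := totally_filter.
  apply: cvg_EFin; first by apply: nearW => J; rewrite /=.
  apply/cvgrPdist_lt => eps eps0.
  have [J0 HJ0] := LP_remainder_small ndX ndY hfY acXY hfYX sq eps0.
  exists J0 => // J /HJ0 DJ /=.
  by rewrite sub0r normrN ger0_norm ?dot_ge0.
move=> j l _ _; rewrite (LP_comomentE hfY acXY hfYX sq).
have se : sq_integrable m (LP_product X Y j l).
  exact/bounded_sq_integrable/bounded_LP_product.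
rewrite /dot /Rintegral fineK; last first.
  by apply: integrable_fin_num => //; exact: sq_integrableM.
rewrite -(integral_quantile2 X Y (G := fun z => (LP_product X Y j l z * q z)%:E)).
  by apply: eq_integral => w _; rewrite -mulrA mulrC.
by apply/measurable_EFinP; apply: measurable_funM => //; have [] := se.
Qed.
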